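(* Let $n\ge2$, and let $\gamma_2=0$, $\gamma_n=-\frac12$ for $n\ge3$. On linear Hopf manifolds of dimension $n$, the Hermitian curvature flows with real coefficients $(a,b,c,d)$ such that $$(n-2)a-2b+(n-1)^2c-(n-1)d>n\frac{\gamma_n}{\gamma_n+1}$$ do not preserve Bismut-Griffiths-non-negativity.
   Context: A linear Hopf manifold of complex dimension $n$ is $M^n=(\mathbb C^n\setminus\{0\})/\!\sim$, where $(z_1,\dots,z_n)\sim(a_1z_1,\dots,a_nz_n)$ for fixed $(a_1,\dots,a_n)\in\mathbb C^n\setminus\{0\}$ with $|a_1|=\dots=|a_n|\ne1$, with its natural complex structure. The Bismut connection $\nabla^+$ of a Hermitian manifold is the unique Hermitian connection ($\nabla^+g=0$, $\nabla^+J=0$) with totally skew-symmetric torsion; its curvature tensor is $\Omega^B(X,Y,Z,W)=g(R^+(X,Y)Z,W)$, $R^+(X,Y)=[\nabla^+_X,\nabla^+_Y]-\nabla^+_{[X,Y]}$, extended complex-multilinearly. A Hermitian metric is Bismut-Griffiths-non-negative if $\Omega^B\in\wedge^{1,1}M\otimes\wedge^{1,1}M$ and $\Omega^B(\xi,\bar\xi,\nu,\bar\nu)\ge0$ for all nonzero $\xi,\nu\in T^{1,0}M$. The Hermitian curvature flow (HCF) with coefficients $(a,b,c,d)$ is $\frac{\partial}{\partial t}g=-S+aQ^1+bQ^2+cQ^3+dQ^4$, where, with $\Omega^{Ch}$ and $T=T^{Ch}$ the curvature and torsion of the Chern connection (torsion indices lowered by $g$, $T_{ik\bar n}=T_{ik}^pg_{p\bar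 n}$, $T_{\bar j\bar l m}=\overline{T_{jl\bar m}}$), $S_{i\bar j}=g^{k\bar l}\Omega^{Ch}_{k\bar li\bar j}$, and $Q^1_{i\bar j}=g^{k\bar l}g^{m\bar n}T_{ik\bar n}T_{\bar j\bar lm}$, $Q^2_{i\bar j}=g^{k\bar l}g^{m\bar n}T_{km\bar j}T_{\bar l\bar ni}$, $Q^3_{i\bar j}=g^{k\bar l}g^{m\bar n}T_{ik\bar l}T_{\bar j\bar nm}$, $Q^4_{i\bar j}=\frac12g^{k\bar l}g^{m\bar n}(T_{mk\bar l}T_{\bar n\bar ji}+T_{mi\bar j}T_{\bar n\bar lk})$. A flow preserves Bismut-Griffiths-non-negativity on a manifold if, for every Bismut-Griffiths-non-negative initial metric, the evolved metrics are Bismut-Griffiths-non-negative for as long as the flow exists. *)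

(* Defs.v *)
From HB Require Import structures.
From mathcomp Require Import all_boot all_order all_algebra.
From mathcomp Require Import all_classical all_reals all_analysis.
From mathcomp Require Import complex.

Set Implicit Arguments.
Unset Strict Implicit.
Unset Printing Implicit Defensive.

Import Order.TTheory GRing.Theory Num.Theory.
Import numFieldNormedType.Exports.

Local Open Scope classical_set_scope.
Local Open Scope ring_scope.
Local Open Scope complex_scope.

Section Calculus.
Context {R : realType}.

(* C^k on an open set U, for maps from a finite-dimensional real space V:
   all iterated directional derivatives of order at most k exist and are
   continuous on U. *)
Fixpoint Ck {V : normedModType R} (k : nat) (U : set V) (f : V -> R) : Prop :=
  (forall p, U p -> {for p, continuous f}) /\
  match k with
  | 0%N => True
  | k'.+1 => forall v : V,
      (forall p, U p -> derivable f p v) /\ Ck k' U ('D_v f)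
  end.

Definition smooth {V : normedModType R} (U : set V) (f : V -> R[i]) : Prop :=
  forall k, Ck k U (fun p => complex.Re (f p)) /\ Ck k U (fun p => complex.Im (f p)).

Definition cderive {V : normedModType R} (v : V) (f : V -> R[i]) (p : V) : R[i] :=
  'D_v (fun q => complex.Re (f q)) p +i* 'D_v (fun q => complex.Im (f q)) p.

End Calculus.

(* The point (x, y) stands for z = x + iy in C^n. *)
Definition Cn (R : realType) (n : nat) : normedModType R :=
  ('rV[R]_n * 'rV[R]_n)%type.

Section Geometry.
Context {R : realType} {n : nat}.
Local Notation C := R[i].
Local Notation Cn := (Cn R n).

(* The number field structure of R[i] also provides an abstract imaginary unit;
   this is the concrete one. *)
Definition iC : C := 0 +i* 1.

Definition zcoord (p : Cn) (k : 'I_n) : C := p.1 0 k +i* p.2 0 k.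

Definition punctured : set Cn := [set p | p != 0].

(* Indices of the complexified coordinate frame: inl k is d/dz_k and
   inr k is d/d(bar z_k). *)
Definition idx : finType := ('I_n + 'I_n)%type.

Definition bar (A : idx) : idx :=
  match A with inl k => inr k | inr k => inl k end.

Definition barred (A : idx) : bool :=
  match A with inl _ => false | inr _ => true end.

Definition partial (A : idx) (f : Cn -> C) (p : Cn) : C :=
  match A with
  | inl k => 2^-1 * (cderive ((delta_mx 0 k, 0) : Cn) f p
                     - iC * cderive ((0, delta_mx 0 k) : Cn) f p)
  | inr k => 2^-1 * (cderive ((delta_mx 0 k, 0) : Cn) f p
                     + iC * cderive ((0, delta_mx 0 k) : Cn) f p)
  end.

(* Eigenvalues of J on the frame. *)
Definition Jeig (A : idx) : C := match A with inl _ => iC | inr _ => - iC end.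

(* Entry (i, j) of the matrix is g(d/dz_i, d/d(bar z_j)). *)
Definition metric_field := Cn -> 'M[C]_n.

Definition is_hermitian_metric (g : metric_field) : Prop :=
  (forall i j, smooth punctured (fun p => g p i j)) /\
  (forall p, punctured p ->
     (forall i j, g p j i = conjc (g p i j)) /\
     (forall v : 'rV[C]_n, v != 0 ->
        0 < \sum_i \sum_j v 0 i * conjc (v 0 j) * g p i j)).

(* Complex-bilinear extension of the metric, in the frame. *)
Definition gc (g : metric_field) (A B : idx) (p : Cn) : C :=
  match A, B with
  | inl i, inr j => g p i j
  | inr j, inl i => g p i j
  | _, _ => 0
  end.

(* gup g k l p is g^{k \bar l}, with sum_l g^{k \bar l} g_{j \bar l} equal to
   the Kronecker symbol of j and k; hence the transposition. *)
Definition gup (g : metric_field) (k l : 'I_n) (p : Cn) : C :=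
  invmx (g p) l k.

(* Gam A B D is the coefficient of the D-th frame field in
   nabla_A (B-th frame field). *)
Definition christoffel := idx -> idx -> idx -> Cn -> C.

Definition torsion (Gam : christoffel) (A B D : idx) (p : Cn) : C :=
  Gam A B D p - Gam B A D p.

Definition torsion_low (g : metric_field) (Gam : christoffel)
    (A B D : idx) (p : Cn) : C :=
  \sum_(E : idx) torsion Gam A B E p * gc g E D p.

(* Component along the D-th frame field of R(A, B) applied to the C-th one,
   with R(X, Y) = [nabla_X, nabla_Y] - nabla_[X, Y]; brackets of coordinate
   fields vanish. *)
Definition curvature (Gam : christoffel) (A B C D : idx) (p : Cn) : R[i] :=
  partial A (Gam B C D) p - partial B (Gam A C D) p
  + \sum_(E : idx) (Gam B C E p * Gam A E D p - Gam A C E p * Gam B E D p).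

Definition curvature_low (g : metric_field) (Gam : christoffel)
    (A B C D : idx) (p : Cn) : R[i] :=
  \sum_(E : idx) curvature Gam A B C E p * gc g E D p.

(* A real affine connection on the punctured space, extended complex-linearly,
   with nabla g = 0 and nabla J = 0. *)
Definition hermitian_connection (g : metric_field) (Gam : christoffel) : Prop :=
  [/\ forall A B D, smooth punctured (Gam A B D),
      forall A B D p, punctured p ->
        Gam (bar A) (bar B) (bar D) p = conjc (Gam A B D p),
      forall A B D p, punctured p ->
        partial A (gc g B D) p =
        \sum_(E : idx) (Gam A B E p * gc g E D p + Gam A D E p * gc g B E p)
    & forall A B D p, punctured p ->
        Jeig B * Gam A B D p = Jeig D * Gam A B D p].

Definition bismut_connection (g : metric_field) (Gam : christoffel) : Prop :=
  hermitian_connection g Gam /\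
  (forall A B D p, punctured p ->
     torsion_low g Gam A B D p = - torsion_low g Gam B A D p /\
     torsion_low g Gam A B D p = - torsion_low g Gam A D B p).

(* The Hermitian connection whose torsion has no (1,1)-part. *)
Definition chern_connection (g : metric_field) (Gam : christoffel) : Prop :=
  hermitian_connection g Gam /\
  (forall (i j : 'I_n) (D : idx) p, punctured p ->
     torsion Gam (inl i) (inr j) D p = 0).

(* The Bismut connection exists and is unique, so the quantifier only names
   it. *)
Definition bismut_griffiths_nonneg (g : metric_field) : Prop :=
  exists Gam, bismut_connection g Gam /\
  forall p, punctured p ->
    (forall A B D E,
       barred A = barred B \/ barred D = barred E ->
       curvature_low g Gam A B D E p = 0) /\
    (forall xi nu : 'rV[C]_n, xi != 0 -> nu != 0 ->
       0 <= \sum_i \sum_j \sum_k \sum_l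
              curvature_low g Gam (inl i) (inr j) (inl k) (inr l) p
              * xi 0 i * conjc (xi 0 j) * nu 0 k * conjc (nu 0 l)).

Section HermitianCurvatureFlow.
Variables (g : metric_field) (Gam : christoffel) (p : Cn).

Definition ricciS (i j : 'I_n) : C :=
  \sum_k \sum_l gup g k l p
    * curvature_low g Gam (inl k) (inr l) (inl i) (inr j) p.

(* T_{ik \bar m} and T_{\bar i \bar k m}. *)
Definition Tlow (i k m : 'I_n) : C :=
  torsion_low g Gam (inl i) (inl k) (inr m) p.
Definition Tlow_bar (i k m : 'I_n) : C := conjc (Tlow i k m).

Definition Q1 (i j : 'I_n) : C :=
  \sum_k \sum_l \sum_m \sum_q gup g k l p * gup g m q p
    * (Tlow i k q * Tlow_bar j l m).
Definition Q2 (i j : 'I_n) : C :=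
  \sum_k \sum_l \sum_m \sum_q gup g k l p * gup g m q p
    * (Tlow k m j * Tlow_bar l q i).
Definition Q3 (i j : 'I_n) : C :=
  \sum_k \sum_l \sum_m \sum_q gup g k l p * gup g m q p
    * (Tlow i k l * Tlow_bar j q m).
Definition Q4 (i j : 'I_n) : C :=
  2^-1 * \sum_k \sum_l \sum_m \sum_q gup g k l p * gup g m q p
    * (Tlow m k l * Tlow_bar q j i + Tlow m i j * Tlow_bar q l k).

Definition hcf_rhs (a b c d : R) (i j : 'I_n) : C :=
  - ricciS i j + a%:C * Q1 i j + b%:C * Q2 i j + c%:C * Q3 i j
  + d%:C * Q4 i j.

End HermitianCurvatureFlow.

(* The linear Hopf manifold of al is the quotient of the punctured space by
   the cyclic group generated by z |-> (al_1 z_1, ..., al_n z_n). *)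
Definition linear_hopf (al : 'rV[C]_n) : Prop :=
  [/\ al != 0, forall i j, `|al 0 i| = `|al 0 j| & forall i, `|al 0 i| != 1].

Definition deck (al : 'rV[C]_n) (p : Cn) : Cn :=
  (\row_k complex.Re (al 0 k * zcoord p k), \row_k complex.Im (al 0 k * zcoord p k)).

(* Hermitian metrics on the Hopf manifold are, by pull-back to the covering
   space, exactly the Hermitian metrics on the punctured space that are
   invariant under the generator of the deck group. The connections and
   curvatures of the quotient are computed upstairs, in the global coordinates
   z_1, ..., z_n. *)
Definition hopf_metric (al : 'rV[C]_n) (g : metric_field) : Prop :=
  is_hermitian_metric g /\
  (forall p, punctured p -> forall i j,
     al 0 i * conjc (al 0 j) * g (deck al p) i j = g p i j).

(* Solution on [0, T). Smoothness up to the initial time means that the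
   components extend smoothly to slightly negative times; the other conditions
   bear only on t in [0, T). *)
Definition hcf_solution (al : 'rV[C]_n) (a b c d : R) (T : R)
    (g : R -> metric_field) : Prop :=
  [/\ exists2 e : R, 0 < e & forall i j,
        smooth [set tp : R * Cn | - e < tp.1 < T /\ punctured tp.2]
          (fun tp => g tp.1 tp.2 i j),
      forall t, 0 <= t < T -> hopf_metric al (g t)
    & forall t, 0 <= t < T -> exists Gam, chern_connection (g t) Gam /\
        forall p, punctured p -> forall i j,
          cderive (1 : R) (fun s => g s p i j) t
          = hcf_rhs (g t) Gam p a b c d i j].

Definition hcf_preserves_bgnn (al : 'rV[C]_n) (a b c d : R) : Prop :=
  forall g0 : metric_field, hopf_metric al g0 -> bismut_griffiths_nonneg g0 ->
  forall (T : R) (g : R -> metric_field),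
    0 < T -> hcf_solution al a b c d T g ->
    (forall p, punctured p -> g 0 p = g0 p) ->
    forall t, 0 <= t < T -> bismut_griffiths_nonneg (g t).

End Geometry.

(* Only used for n >= 2. *)
Definition gamma_ (R : realType) (n : nat) : R :=
  if n == 2%N then 0 else - 2^-1.

(* Main.v *)
From HB Require Import structures.
From mathcomp Require Import all_boot all_order all_algebra.
From mathcomp Require Import all_classical all_reals all_analysis.
From mathcomp Require Import complex ring lra.
Require Import Defs.

Set Implicit Arguments.
Unset Strict Implicit.
Unset Printing Implicit Defensive.

Import Order.TTheory GRing.Theory Num.Theory.
Import numFieldNormedType.Exports.

Local Open Scope classical_set_scope.
Local Open Scope ring_scope.
Local Open Scope complex_scope.

(** Write r = |z|^2, w_k for the conjugate of z_k, and P_(ij) = w_i z_j / r for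
the projection onto the radial direction, with complement q = 1 - P.  The
metrics
  g_(x,y) = (1/r) (x q + y P),   x, y > 0,
are invariant under the unitary group and under homotheties, so they descend
to every linear Hopf manifold, and every natural tensor of this type built
from them is again a combination of q / r and P / r.  Two computations,
whose outcome depends only on the ratio u = y / x up to a positive factor, then
settle the question.

The Bismut curvature is of type (1,1) in both pairs of indices and equals
  (x / r^2) (q_(il) q_(kj) - (2u - 1) q_(ij) q_(kl))
([hopf_bismut_low]).  The form q has rank n - 1.  If n = 2 the two products
coincide and the curvature is nonnegative exactly when u <= 1; if n >= 3, two
orthogonal vectors in the image of q show that it is nonnegative exactly when
2u - 1 <= 0.  In both cases the threshold is u = 1 + gamma_n ([hopf_bgnn],
[hopf_not_bgnn]).  That the curvature condition fails for the given metric
uses that the Bismut connection is unique ([bismut_unique]).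

Evaluating S and the Q^i on g_(x,y) ([hopf_hcf]) reduces the flow to
  x' = - n + u (1 + a + 2b + (n-1) d),
  y' = u^2 ((n-1)(a-1) + (n-1)^2 c),
so that, with L the left-hand side of the hypothesis,
  u' = (u / x) (n (1 - u) + L u).
At u = 1 + gamma_n the hypothesis says exactly that u' > 0.  The solution that
starts at the threshold therefore has a Bismut-Griffiths-non-negative initial
metric and leaves the condition at once.

The system is solved by separation of variables ([hopf_flow_exists]): y and x
are functions of u, because dy/du is y times a function of u, and the time is
an antiderivative of a positive function of u, to be inverted
([autonomous_ode]). *)

(** * Functions of class C^k on open sets *)

Section CkTheory.
Context {R : realType}.
Implicit Types V W : normedModType R.

Lemma open_near V (U : set V) p : open U -> U p -> \forall q \near p, U q.
Proof. by move=> oU Up; exact: open_nbhs_nbhs. Qed.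

Lemma eq_on_near V (U : set V) T (f h : V -> T) p : open U -> U p ->
  (forall q, U q -> f q = h q) -> \forall q \near p, f q = h q.
Proof. by move=> oU Up e; near=> q; apply: e; near: q; exact: open_near. 
Unshelve. all: by end_near. Qed.

Lemma Ck_cont V k (U : set V) (f : V -> R) : Ck k U f ->
  forall p, U p -> {for p, continuous f}.
Proof. by case: k => [|k] []. Qed.

Lemma CkS V k (U : set V) (f : V -> R) : Ck k.+1 U f -> Ck k U f.
Proof.
elim: k f => [|k IH] f [cf df]; first by split.
by split=> // v; have [d1 d2] := df v; split => //; exact: IH.
Qed.

(** Both continuity and directional derivatives are local, so the values
outside the open set are irrelevant. *)
Lemma Ck_ext V k (U : set V) (f h : V -> R) : open U ->
  (forall q, U q -> f q = h q) -> Ck k U f -> Ck k U h.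
Proof.
move=> oU; elim: k f h => [|k IH] f h e [cf df].
  split=> // p Up; rewrite /prop_for /continuous_at -(e _ Up).
  apply: cvg_trans (cf _ Up); apply: near_eq_cvg.
  exact: (eq_on_near oU Up e).
split.
  move=> p Up; rewrite /prop_for /continuous_at -(e _ Up).
  apply: cvg_trans (cf _ Up); apply: near_eq_cvg.
  exact: (eq_on_near oU Up e).
move=> v; have [d1 d2] := df v; split.
  by move=> p Up; exact: near_eq_derivable (eq_on_near oU Up e) (d1 p Up).
by apply: IH d2 => q Uq; apply: near_eq_derive; exact: (eq_on_near oU Uq e).
Qed.

Lemma Ck_cst V k (U : set V) (c : R) : Ck k U (fun=> c).
Proof.
elim: k c => [|k IH] c; (split; first by move=> p _; exact: cst_continuous) => //.
move=> v; split; first by move=> p _; exact: derivable_cst.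
rewrite (_ : 'D_v _ = fun=> 0) //; apply/funext => p; exact: derive_cst.
Qed.

Lemma CkD V k (U : set V) (f h : V -> R) : open U ->
  Ck k U f -> Ck k U h -> Ck k U (fun p => f p + h p).
Proof.
move=> oU; elim: k f h => [|k IH] f h [cf df] [ch dh].
  by split=> // p Up; exact: continuousD (cf p Up) (ch p Up).
split; first by move=> p Up; exact: continuousD (cf p Up) (ch p Up).
move=> v; have [d1 d2] := df v; have [e1 e2] := dh v; split.
  by move=> p Up; exact: derivableD (d1 p Up) (e1 p Up).
apply: Ck_ext (IH _ _ d2 e2) => // p Up.
by rewrite -deriveD //; [exact: d1|exact: e1].
Qed.

Lemma CkM V k (U : set V) (f h : V -> R) : open U ->
  Ck k U f -> Ck k U h -> Ck k U (fun p => f p * h p).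
Proof.
move=> oU; elim: k f h => [|k IH] f h kf kh.
  by split=> // p Up; exact: continuousM (Ck_cont kf Up) (Ck_cont kh Up).
split; first by move=> p Up; exact: continuousM (Ck_cont kf Up) (Ck_cont kh Up).
move=> v; have [d1 d2] := kf.2 v; have [e1 e2] := kh.2 v; split.
  by move=> p Up; exact: derivableM (d1 p Up) (e1 p Up).
apply: (@Ck_ext _ _ _ (fun p => f p * 'D_v h p + h p * 'D_v f p)) => //.
  by move=> p Up; rewrite (deriveM (d1 p Up) (e1 p Up)).
by apply: CkD => //; apply: IH => //; exact: CkS.
Qed.

Lemma CkN V k (U : set V) (f : V -> R) : open U ->
  Ck k U f -> Ck k U (fun p => - f p).
Proof.
move=> oU kf; apply: (@Ck_ext _ _ _ (fun p => -1 * f p)) => //.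
  by move=> q _; rewrite mulN1r.
by apply: CkM => //; exact: Ck_cst.
Qed.

(** The derivative of 1 / f is a polynomial in 1 / f and f', so each order of
regularity of 1 / f gives the next one. *)
Lemma CkV V k (U : set V) (f : V -> R) : open U ->
  (forall p, U p -> f p != 0) -> Ck k U f -> Ck k U (fun p => (f p)^-1).
Proof.
move=> oU f0; elim: k => [|k IH] kf.
  by split=> // p Up; apply: continuousV; [exact: f0|exact: (Ck_cont kf Up)].
split.
  by move=> p Up; apply: continuousV; [exact: f0|exact: (Ck_cont kf Up)].
move=> v; have [d1 d2] := kf.2 v; split.
  by move=> p Up; apply: derivableV; [exact: f0|exact: d1].
have kV := IH (CkS kf).
apply: (@Ck_ext _ _ _ (fun p => - (((f p)^-1 * (f p)^-1) * 'D_v f p))) => //.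
  by move=> p Up; rewrite (deriveV (f0 p Up) (d1 p Up)) -mulNr expr2 invfM.
by apply: CkN => //; apply: CkM => //; exact: CkM.
Qed.

(** Along a line, composing with a linear map only changes the
direction.  Substitutions of linear maps therefore preserve C^k without any
appeal to the total differential. *)
Lemma growth_comp_lin V W (L : V -> W) (f : W -> R) v p :
  (forall a x y, L (a *: x + y) = a *: L x + L y) ->
  (fun h : R => h^-1 *: (((f \o L) \o shift p) (h *: v) - (f \o L) p))
  = (fun h : R => h^-1 *: ((f \o shift (L p)) (h *: L v) - f (L p))).
Proof. by move=> lL; apply/funext => h /=; rewrite lL. Qed.

Lemma D_comp_lin V W (L : V -> W) (f : W -> R) v p :
  (forall a x y, L (a *: x + y) = a *: L x + L y) ->
  'D_v (f \o L) p = 'D_(L v) f (L p).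
Proof. by move=> lL; rewrite /derive (growth_comp_lin f v p lL). Qed.

Lemma derivable_comp_lin V W (L : V -> W) (f : W -> R) v p :
  (forall a x y, L (a *: x + y) = a *: L x + L y) ->
  derivable f (L p) (L v) -> derivable (f \o L) p v.
Proof. by move=> lL; rewrite /derivable (growth_comp_lin f v p lL). Qed.

Lemma Ck_comp_lin V W k (L : V -> W) (U : set W) (U' : set V) (f : W -> R) :
  (forall a x y, L (a *: x + y) = a *: L x + L y) -> continuous L ->
  (forall p, U' p -> U (L p)) ->
  Ck k U f -> Ck k U' (f \o L).
Proof.
move=> lL cL sU; elim: k f => [|k IH] f [cf df].
  split=> // p Up; apply: continuous_comp; [exact: cL|exact/cf/sU].
split.
  move=> p Up; apply: continuous_comp; [exact: cL|exact/cf/sU].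
move=> v; have [d1 d2] := df (L v); split.
  by move=> p Up; apply: derivable_comp_lin => //; exact/d1/sU.
rewrite (_ : 'D_v _ = ('D_(L v) f) \o L); first exact: IH.
by apply/funext => p; exact: D_comp_lin.
Qed.

Lemma Ck_id k (U : set R) : Ck k U (id : R -> R).
Proof.
case: k => [|k]; (split; first by move=> p _; exact: cvg_id) => // v.
split; first by move=> p _; exact: derivable_id.
by rewrite (_ : 'D_v _ = fun=> v); [exact: Ck_cst|apply/funext => p; exact: derive_id].
Qed.

Lemma Ck_lin V k (U : set V) (L : V -> R) :
  (forall a x y, L (a *: x + y) = a *: L x + L y) -> continuous L ->
  Ck k U L.
Proof. by move=> lL cL; apply: (@Ck_comp_lin _ _ k L setT U id) => //; exact: Ck_id. Qed.

End CkTheory.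

(** * Wirtinger derivatives on the punctured space *)

Section SmoothTheory.
Context {R : realType}.
Implicit Types V W : normedModType R.
Local Notation C := R[i].
Local Notation Re := complex.Re.
Local Notation Im := complex.Im.

Lemma complex_ReD (x y : C) : Re (x + y) = Re x + Re y. Proof. by case: x; case: y. Qed.
Lemma complex_ImD (x y : C) : Im (x + y) = Im x + Im y. Proof. by case: x; case: y. Qed.
Lemma complex_ReM (x y : C) : Re (x * y) = Re x * Re y - Im x * Im y.
Proof. by case: x; case: y. Qed.
Lemma complex_ImM (x y : C) : Im (x * y) = Re x * Im y + Im x * Re y.
Proof. by case: x; case: y. Qed.
Lemma complex_Re_conj (x : C) : Re (conjc x) = Re x. Proof. by case: x. Qed.
Lemma complex_Im_conj (x : C) : Im (conjc x) = - Im x. Proof. by case: x. Qed.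

Lemma conjcD (x y : C) : conjc (x + y) = conjc x + conjc y. Proof. exact: rmorphD. Qed.
Lemma conjcM (x y : C) : conjc (x * y) = conjc x * conjc y. Proof. exact: rmorphM. Qed.
Lemma conjcN (x : C) : conjc (- x) = - conjc x. Proof. exact: rmorphN. Qed.
Lemma conjc_sum (I : Type) (s : seq I) (P : pred I) (F : I -> C) :
  conjc (\sum_(i <- s | P i) F i) = \sum_(i <- s | P i) conjc (F i).
Proof. exact: rmorph_sum. Qed.

Section Closure.
Context {V : normedModType R} (U : set V) (oU : open U).

Lemma smooth_ext (f h : V -> C) :
  (forall q, U q -> f q = h q) -> smooth U f -> smooth U h.
Proof.
move=> e sf k; have [s1 s2] := sf k.
by split; [apply: Ck_ext s1|apply: Ck_ext s2] => // q Uq; rewrite e.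
Qed.

Lemma smooth_cst (c : C) : smooth U (fun=> c).
Proof. by move=> k; split; exact: Ck_cst. Qed.

Lemma smooth_real (f : V -> R) : (forall k, Ck k U f) -> smooth U (fun p => (f p)%:C).
Proof. by move=> sf k; split; [exact: sf|exact: Ck_cst]. Qed.

Lemma smoothD (f h : V -> C) : smooth U f -> smooth U h -> smooth U (fun p => f p + h p).
Proof.
move=> sf sh k; have [f1 f2] := sf k; have [h1 h2] := sh k; split.
  by apply: (Ck_ext oU _ (CkD oU f1 h1)) => q _; rewrite complex_ReD.
by apply: (Ck_ext oU _ (CkD oU f2 h2)) => q _; rewrite complex_ImD.
Qed.

Lemma smoothM (f h : V -> C) : smooth U f -> smooth U h -> smooth U (fun p => f p * h p).
Proof.
move=> sf sh k; have [f1 f2] := sf k; have [h1 h2] := sh k; split.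
  apply: (Ck_ext oU _ (CkD oU (CkM oU f1 h1) (CkN oU (CkM oU f2 h2)))) => q _.
  by rewrite complex_ReM.
apply: (Ck_ext oU _ (CkD oU (CkM oU f1 h2) (CkM oU f2 h1))) => q _.
by rewrite complex_ImM.
Qed.

Lemma smooth_conj (f : V -> C) : smooth U f -> smooth U (fun p => conjc (f p)).
Proof.
move=> sf k; have [f1 f2] := sf k; split.
  by apply: (Ck_ext oU _ f1) => q _; rewrite complex_Re_conj.
by apply: (Ck_ext oU _ (CkN oU f2)) => q _; rewrite complex_Im_conj.
Qed.

Lemma smooth_derivable (f : V -> C) v p : smooth U f -> U p ->
  derivable (fun q => Re (f q)) p v /\ derivable (fun q => Im (f q)) p v.
Proof.
by move=> sf Up; have [[_ f1] [_ f2]] := sf 1%N; split; [apply: (f1 v).1|apply: (f2 v).1].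
Qed.

Lemma eq_cderive (f h : V -> C) v p : U p -> (forall q, U q -> f q = h q) ->
  cderive v f p = cderive v h p.
Proof.
move=> Up e; rewrite /cderive; congr (_ +i* _); apply: near_eq_derive.
  by apply: (eq_on_near oU Up) => q Uq; rewrite e.
by apply: (eq_on_near oU Up) => q Uq; rewrite e.
Qed.

Lemma cderive_cst (c : C) (v p : V) : cderive v (fun=> c) p = 0.
Proof. by rewrite /cderive !derive_cst. Qed.

Lemma cderiveD (f h : V -> C) v p : smooth U f -> smooth U h -> U p ->
  cderive v (fun q => f q + h q) p = cderive v f p + cderive v h p.
Proof.
move=> sf sh Up; have [f1 f2] := smooth_derivable v sf Up.
have [h1 h2] := smooth_derivable v sh Up.
rewrite /cderive; apply/eqP; rewrite eq_complex /=; apply/andP; split; apply/eqP.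
  by rewrite -deriveD //; congr (derive _ p v); apply/funext => q /=; rewrite complex_ReD.
by rewrite -deriveD //; congr (derive _ p v); apply/funext => q /=; rewrite complex_ImD.
Qed.

Lemma cderiveM (f h : V -> C) v p : smooth U f -> smooth U h -> U p ->
  cderive v (fun q => f q * h q) p = cderive v f p * h p + f p * cderive v h p.
Proof.
move=> sf sh Up; have [f1 f2] := smooth_derivable v sf Up.
have [h1 h2] := smooth_derivable v sh Up.
rewrite /cderive.
have -> : (fun q => Re (f q * h q)) =
  ((fun q => Re (f q)) * (fun q => Re (h q)) - (fun q => Im (f q)) * (fun q => Im (h q))).
  by apply/funext => q; rewrite complex_ReM.
have -> : (fun q => Im (f q * h q)) =
  ((fun q => Re (f q)) * (fun q => Im (h q)) + (fun q => Im (f q)) * (fun q => Re (h q))).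
  by apply/funext => q; rewrite complex_ImM.
rewrite (deriveB (derivableM f1 h1) (derivableM f2 h2)).
rewrite (deriveD (derivableM f1 h2) (derivableM f2 h1)).
rewrite (deriveM f1 h1) (deriveM f2 h2) (deriveM f1 h2) (deriveM f2 h1).
move: ('D_v (fun q => Re (f q)) p) ('D_v (fun q => Im (f q)) p) => a b.
move: ('D_v (fun q => Re (h q)) p) ('D_v (fun q => Im (h q)) p) => a' b'.
apply/eqP; rewrite eq_complex !(complex_ReD, complex_ImD, complex_ReM,
  complex_ImM) /= /GRing.scale /=.
move: (Re (f p)) (Im (f p)) (Re (h p)) (Im (h p)) => x y x' y'.
by apply/andP; split; apply/eqP; ring.
Qed.

Lemma cderive_conj (f : V -> C) v p : smooth U f -> U p ->
  cderive v (fun q => conjc (f q)) p = conjc (cderive v f p).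
Proof.
move=> sf Up; have [f1 f2] := smooth_derivable v sf Up; rewrite /cderive /=.
congr (_ +i* _); first by congr (derive _ p v); apply/funext => q; rewrite complex_Re_conj.
rewrite -deriveN //; congr (derive _ p v); apply/funext => q; exact: complex_Im_conj.
Qed.

End Closure.
End SmoothTheory.

Section Partials.
Context {R : realType} {n : nat}.
Local Notation C := R[i].
Local Notation Cn := (Cn R n).
Local Notation idx := (@idx n).
Local Notation Re := complex.Re.
Local Notation Im := complex.Im.
Implicit Types (f h : Cn -> C) (A B : idx).

Lemma open_punctured : open (@punctured R n).
Proof.
have -> : @punctured R n = ~` [set 0].
  by apply/seteqP; split => p /= /eqP.
by apply: closed_openC; apply: accessible_closed_set1; apply: hausdorff_accessible;
   exact: norm_hausdorff.
Qed.
Local Notation oP := open_punctured.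
Local Notation sm := (smooth punctured).

Lemma barK : involutive (@bar n). Proof. by case. Qed.

Lemma partial_ext A f h p : punctured p ->
  (forall q, punctured q -> f q = h q) -> partial A f p = partial A h p.
Proof. by move=> Pp e; case: A => k /=; rewrite !(eq_cderive oP _ Pp e). Qed.

Lemma partial_cst A (c : C) p : partial A (fun=> c) p = 0.
Proof. by case: A => k /=; rewrite !cderive_cst !(mulr0, subr0, addr0). Qed.

Lemma partialD A f h p : sm f -> sm h -> punctured p ->
  partial A (fun q => f q + h q) p = partial A f p + partial A h p.
Proof. 
move=> sf sh Pp; case: A => k /=; rewrite !(cderiveD _ sf sh Pp);
by move: (2^-1) iC (cderive _ _ _) (cderive _ _ _) (cderive _ _ _) (cderive _ _ _)
  => *; ring.
Qed.

Lemma partialM A f h p : sm f -> sm h -> punctured p ->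
  partial A (fun q => f q * h q) p = partial A f p * h p + f p * partial A h p.
Proof. 
move=> sf sh Pp; case: A => k /=; rewrite !(cderiveM _ sf sh Pp);
by move: (2^-1) iC (f p) (h p) (cderive _ _ _) (cderive _ _ _) (cderive _ _ _) (cderive _ _ _)
  => *; ring.
Qed.

(** Conjugation exchanges d/dz_k and d/d(bar z_k). *)
Lemma partial_conj A f p : sm f -> punctured p ->
  partial (bar A) (fun q => conjc (f q)) p = conjc (partial A f p).
Proof.
move=> sf Pp; have iJ : conjc (iC : C) = - iC by rewrite /iC /= /GRing.opp /= oppr0.
have hJ : conjc (2^-1 : C) = 2^-1 by rewrite conjc_inv conjc_nat.
case: A => k; rewrite /partial /bar !(cderive_conj _ sf Pp) !(conjcM, conjcD, conjcN) hJ iJ.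
  by congr (_ * (_ + _)); rewrite mulNr opprK.
by congr (_ * (_ + _)); rewrite mulNr.
Qed.

(** Carrying the derivatives together with smoothness lets both be
obtained at once from the shape of an expression. *)
Definition has_partials f (D : idx -> Cn -> C) :=
  sm f /\ forall A p, punctured p -> partial A f p = D A p.

Lemma has_partials_eq f D D' :
  (forall A p, punctured p -> D A p = D' A p) -> has_partials f D -> has_partials f D'.
Proof. by move=> e [sf pf]; split => // A p Pp; rewrite pf // e. Qed.

Lemma has_partials_cst c : has_partials (fun=> c) (fun _ _ => 0).
Proof. by split; [exact: smooth_cst|move=> A p _; exact: partial_cst]. Qed.

Lemma has_partialsD f h D E : has_partials f D -> has_partials h E ->
  has_partials (fun p => f p + h p) (fun A p => D A p + E A p).
Proof.
move=> [sf pf] [sh ph]; split; first exact: smoothD oP _ _ sf sh.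
by move=> A p Pp; rewrite partialD // pf // ph.
Qed.

Lemma has_partialsM f h D E : has_partials f D -> has_partials h E ->
  has_partials (fun p => f p * h p) (fun A p => D A p * h p + f p * E A p).
Proof.
move=> [sf pf] [sh ph]; split; first exact: smoothM oP _ _ sf sh.
by move=> A p Pp; rewrite partialM // pf // ph.
Qed.

Lemma has_partialsZ c f D : has_partials f D ->
  has_partials (fun p => c * f p) (fun A p => c * D A p).
Proof.
move=> /(has_partialsM (has_partials_cst c)); apply: has_partials_eq => A p _.
by rewrite mul0r add0r.
Qed.

Lemma has_partialsN f D : has_partials f D ->
  has_partials (fun p => - f p) (fun A p => - D A p).
Proof.
move=> /(has_partialsZ (-1)) H; rewrite (_ : (fun p => - f p) = (fun p => -1 * f p)).
  by apply: has_partials_eq H => A p _; rewrite mulN1r.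
by apply/funext => p; rewrite mulN1r.
Qed.

Lemma has_partialsB f h D E : has_partials f D -> has_partials h E ->
  has_partials (fun p => f p - h p) (fun A p => D A p - E A p).
Proof. by move=> hf hh; exact: has_partialsD (has_partialsN hh). Qed.

Lemma has_partials_sum (I : Type) (s : seq I) (f : I -> Cn -> C) D :
  (forall i, has_partials (f i) (D i)) ->
  has_partials (fun p => \sum_(i <- s) f i p) (fun A p => \sum_(i <- s) D i A p).
Proof.
move=> H; elim: s => [|i s IH].
  rewrite (_ : (fun p => _) = fun=> 0); last by apply/funext => p; rewrite big_nil.
  by apply: has_partials_eq (has_partials_cst 0) => A p _; rewrite big_nil.
rewrite (_ : (fun p => _) = (fun p => f i p + \sum_(i <- s) f i p)).
  by apply: has_partials_eq (has_partialsD (H i) IH) => A p _; rewrite big_cons.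
by apply/funext => p; rewrite big_cons.
Qed.

Lemma has_partials_conj f D : has_partials f D ->
  has_partials (fun p => conjc (f p)) (fun A p => conjc (D (bar A) p)).
Proof.
move=> [sf pf]; split; first exact: smooth_conj oP _ sf.
by move=> A p Pp; rewrite -{1}(barK A) partial_conj // pf.
Qed.

(** The coordinates dual to the complexified frame: z_k and its conjugate. *)
Definition zeta A (p : Cn) : C :=
  match A with inl k => zcoord p k | inr k => conjc (zcoord p k) end.

Lemma continuous_re_coord k : continuous (fun p : Cn => p.1 0 k).
Proof.
by move=> p; apply: (@continuous_comp _ _ _ fst (fun M : 'rV[R]_n => M 0 k));
  [exact: cvg_fst|exact: coord_continuous].
Qed.

Lemma continuous_im_coord k : continuous (fun p : Cn => p.2 0 k).
Proof.
by move=> p; apply: (@continuous_comp _ _ _ snd (fun M : 'rV[R]_n => M 0 k));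
  [exact: cvg_snd|exact: coord_continuous].
Qed.

Lemma linear_re_coord k a (x y : Cn) : (a *: x + y).1 0 k = a *: x.1 0 k + y.1 0 k.
Proof. by rewrite !mxE. Qed.

Lemma linear_im_coord k a (x y : Cn) : (a *: x + y).2 0 k = a *: x.2 0 k + y.2 0 k.
Proof. by rewrite !mxE. Qed.

Lemma D_lin (V : normedModType R) (L : V -> R) v p :
  (forall a x y, L (a *: x + y) = a *: L x + L y) -> 'D_v L p = L v.
Proof. by move=> lL; rewrite (@D_comp_lin R V R L id v p lL) derive_id. Qed.

Lemma has_partials_zeta B : has_partials (zeta B) (fun A _ => (A == B)%:R).
Proof.
have hz k : has_partials (fun p => zcoord p k) (fun A _ => (A == inl k)%:R).
  split.
    move=> j; split; first exact: Ck_lin (@linear_re_coord k) (@continuous_re_coord k).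
    exact: Ck_lin (@linear_im_coord k) (@continuous_im_coord k).
  have e l : (delta_mx 0 l : 'rV[R]_n) 0 k = (l == k)%:R by rewrite mxE eqxx eq_sym.
  have z : (0 : 'rV[R]_n) 0 k = 0 by rewrite mxE.
  have d (v p : Cn) : cderive v (fun q => zcoord q k) p = v.1 0 k +i* v.2 0 k.
    rewrite /cderive; congr (_ +i* _); first exact: (D_lin v p (@linear_re_coord k)).
    exact: (D_lin v p (@linear_im_coord k)).
  move=> A p Pp; case: A => l; rewrite /partial !d [_.1]/= [_.2]/= !(e, z).
    rewrite (_ : (inl l == inl k :> idx) = (l == k)) //.
    by case: (l == k); apply/eqP; rewrite eq_complex /iC !(complex_ReM, complex_ImM,
      complex_ReD, complex_ImD) /=;
    apply/andP; split; apply/eqP; field.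
  rewrite (_ : (inr l == inl k :> idx) = false) //.
  by case: (l == k); apply/eqP; rewrite eq_complex /iC !(complex_ReM, complex_ImM, complex_ReD,
    complex_ImD) /=;
    apply/andP; split; apply/eqP; field.
case: B => k; first exact: hz.
apply: has_partials_eq (has_partials_conj (hz k)) => A p _.
by rewrite conjc_nat; congr (_%:R); case: A.
Qed.

Definition normsq (p : Cn) : C := \sum_k zeta (inl k) p * zeta (inr k) p.
Definition rho (p : Cn) : C := (normsq p)^-1.

Lemma normsqE p : normsq p = (\sum_k ((p.1 0 k) ^+ 2 + (p.2 0 k) ^+ 2))%:C.
Proof.
rewrite rmorph_sum; apply: eq_bigr => k _ /=; rewrite /zcoord.
by apply/eqP; rewrite eq_complex /=; apply/andP; split; apply/eqP; ring.
Qed.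

Lemma normsq_gt0 p : punctured p -> 0 < normsq p.
Proof.
move=> Pp; rewrite normsqE ltcR lt_def.
have ge k : 0 <= p.1 0 k ^+ 2 + p.2 0 k ^+ 2 by rewrite addr_ge0 ?sqr_ge0.
rewrite sumr_ge0 ?andbT//.
apply: contra_neq Pp => /eqP; rewrite psumr_eq0// => /allP H.
case: p H ge => x y /= H ge; congr pair; apply/rowP => k; rewrite !mxE;
  have := H k (mem_index_enum k); rewrite paddr_eq0 ?sqr_ge0// !sqrf_eq0;
  by case/andP => /eqP e1 /eqP e2; rewrite ?e1 ?e2.
Qed.

Lemma normsq_neq0 p : punctured p -> normsq p != 0.
Proof. by move=> /normsq_gt0; rewrite lt_def => /andP[]. Qed.

Lemma has_partials_normsq : has_partials normsq (fun A p => zeta (bar A) p).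
Proof.
apply: (has_partials_eq _ (has_partials_sum (index_enum 'I_n)
  (fun k => has_partialsM (has_partials_zeta (inl k)) (has_partials_zeta (inr k))))).
move=> A p _; have e l k : (inl l == inl k :> idx) = (l == k) by [].
have e' l k : (inr l == inr k :> idx) = (l == k) by [].
have f l k : (inl l == inr k :> idx) = false by [].
have f' l k : (inr l == inl k :> idx) = false by [].
case: A => l; rewrite (bigD1 l) //= big1 ?(e, e', f, f') ?eqxx ?(mul0r, mulr0, mul1r, mulr1,
  add0r, addr0) //.
  by move=> k kl; rewrite ?(e, f) [l == k]eq_sym (negbTE kl) !(mul0r, mulr0, addr0).
by move=> k kl; rewrite ?(e', f') [l == k]eq_sym (negbTE kl) !(mul0r, mulr0, addr0).
Qed.

Lemma rhoE p : rho p = ((Re (normsq p))^-1)%:C.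
Proof. by rewrite fmorphV /rho normsqE. Qed.

Lemma smooth_rho : sm rho.
Proof.
suff : sm (fun p => ((Re (normsq p))^-1)%:C).
  by move=> H; rewrite (_ : rho = (fun p => ((Re (normsq p))^-1)%:C)) //; apply/funext => p;
    exact: rhoE.
apply: smooth_real => k; apply: CkV; [exact: oP| |exact: (has_partials_normsq.1 k).1].
by move=> p /normsq_neq0; rewrite normsqE eq_complex /= eqxx andbT.
Qed.

(** Differentiate rho * |z|^2 = 1. *)
Lemma has_partials_rho : has_partials rho (fun A p => - (rho p ^+ 2 * zeta (bar A) p)).
Proof.
split; first exact: smooth_rho.
move=> A p Pp.
have := partialM A smooth_rho has_partials_normsq.1 Pp.
rewrite (partial_ext A Pp (h := fun=> 1)) ?partial_cst; last first.
  by move=> q Pq; rewrite /rho mulVf // normsq_neq0.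
rewrite has_partials_normsq.2 // => /esym/eqP;
  rewrite addr_eq0 => /eqP /(congr1 (fun x => x * rho p)).
rewrite -mulrA /rho mulfV ?normsq_neq0 // mulr1 => ->; ring.
Qed.

End Partials.

(** * Contractions with a matrix of the form scalar plus rank one *)

Section Contraction.
Variables (F : fieldType) (n : nat).
Implicit Types (f u v : 'I_n -> F) (i j k l m e : 'I_n).

Definition kron i j : F := (i == j)%:R.

Lemma kronC i j : kron i j = kron j i. Proof. by rewrite /kron eq_sym. Qed.

Lemma kronxx i : kron i i = 1. Proof. by rewrite /kron eqxx. Qed.

Lemma sum_kronl f i : \sum_k kron i k * f k = f i.
Proof.
rewrite (bigD1 i) //= big1 ?addr0; first by rewrite /kron eqxx mul1r.
by move=> k ki; rewrite /kron eq_sym (negbTE ki) mul0r.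
Qed.

Lemma sum_kronr f i : \sum_k f k * kron i k = f i.
Proof. by rewrite -[RHS]sum_kronl; apply: eq_bigr => k _; rewrite mulrC. Qed.

Lemma sum_kronr_sym f i : \sum_k f k * kron k i = f i.
Proof. by rewrite -[RHS]sum_kronr; apply: eq_bigr => k _; rewrite kronC. Qed.

Lemma sum_lin f u v a b :
  \sum_k f k * (a * u k + b * v k) = a * (\sum_k f k * u k) + b * (\sum_k f k * v k).
Proof. by rewrite !mulr_sumr -big_split; apply: eq_bigr => k _ /=; ring. Qed.

Variables z w : 'I_n -> F.
Let r := \sum_k w k * z k.

(** Every matrix of connection symbols below has this shape, so all
quadratic terms of the curvatures are instances of this product. *)
Lemma sum_rank1 (p q t s : 'I_n -> F) a b k m :
  \sum_e (p k * q e + b * kron k e) * (t e * s m + a * kron e m)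
  = p k * s m * (\sum_e q e * t e) + a * (p k * q m) + b * (t k * s m) + a * b * kron k m.
Proof.
transitivity (\sum_e (p k * s m * (q e * t e) + a * (p k * q e * kron e m)
   + b * s m * (kron k e * t e) + a * b * (kron k e * kron e m))).
  by apply: eq_bigr => e _; ring.
rewrite !big_split /= -!mulr_sumr sum_kronl sum_kronl sum_kronr_sym.
by ring.
Qed.

Section Inverse.
Variables (h s : F).
(** The shape of the inverse of an invariant metric.  It is used through
[rk1_z], [rk1_w] and [rk1_tr]: z and w are eigenvectors, of eigenvalue
h + s |z|^2. *)
Definition rk1 i j := h * kron i j + s * (z i * w j).
Let H := rk1.
Let c := h + s * r.

Lemma rk1_z i : \sum_k H i k * z k = c * z i.
Proof.
transitivity (\sum_k (h * (kron i k * z k) + s * z i * (w k * z k))).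
  by apply: eq_bigr => k _; rewrite /H /rk1; ring.
by rewrite big_split /= -!mulr_sumr sum_kronl -/r /c; ring.
Qed.

Lemma rk1_w i : \sum_k w k * H k i = c * w i.
Proof.
transitivity (\sum_k (h * (w k * kron k i) + s * w i * (w k * z k))).
  by apply: eq_bigr => k _; rewrite /H /rk1; ring.
by rewrite big_split /= -!mulr_sumr sum_kronr_sym -/r /c; ring.
Qed.

Lemma rk1_tr : \sum_k H k k = n%:R * h + s * r.
Proof.
transitivity (\sum_k (h + s * (w k * z k))).
  by apply: eq_bigr => k _; rewrite /H /rk1 kronxx; ring.
by rewrite big_split /= -mulr_sumr sumr_const card_ord -[h *+ n]mulr_natl.
Qed.

Lemma rk1_sqr i j : \sum_k H i k * H k j = h * H i j + c * s * (z i * w j).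
Proof.
transitivity (\sum_k (h * (kron i k * H k j) + s * z i * (w k * H k j))).
  by apply: eq_bigr => k _; rewrite /H /rk1; ring.
by rewrite big_split /= -!mulr_sumr sum_kronl rk1_w; ring.
Qed.

Variable tau : F.
(** The Chern torsion of an invariant metric, with lowered last index;
[torsbar] is its conjugate. *)
Definition tors i j k := tau * (w j * kron i k - w i * kron j k).
Definition torsbar i j k := tau * (z j * kron i k - z i * kron j k).
Let T := tors.
Let T' := torsbar.

Lemma tors_trace i : \sum_k \sum_l H k l * T i k l = - ((n%:R - 1) * h * tau * w i).
Proof.
transitivity (\sum_k (tau * (w k * H k i) - tau * w i * H k k)).
  apply: eq_bigr => k _.
  transitivity (\sum_l H k l * (tau * w k * kron i l + (- tau * w i) * kron k l)).
    by apply: eq_bigr => l _; rewrite /T /tors; ring.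
  by rewrite sum_lin !sum_kronr; ring.
by rewrite big_split /= sumrN -!mulr_sumr rk1_w rk1_tr /c; ring.
Qed.

Lemma torsbar_trace j : \sum_k \sum_l H k l * T' j l k = - ((n%:R - 1) * h * tau * z j).
Proof.
transitivity (\sum_k (tau * c * (kron j k * z k) - tau * z j * H k k)).
  apply: eq_bigr => k _.
  transitivity (\sum_l H k l * (tau * kron j k * z l + (- tau * z j) * kron k l)).
    by apply: eq_bigr => l _; rewrite /T' /torsbar [kron l k]kronC; ring.
  by rewrite sum_lin !sum_kronr rk1_z; ring.
by rewrite big_split /= sumrN -!mulr_sumr sum_kronl rk1_tr /c; ring.
Qed.

(** [quad1] to [quad4] evaluate the quadratic expressions Q^1 to Q^4.  The
torsion is built from w and Kronecker symbols, so each contraction is either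
with an eigenvector of H or a trace of H or of its square. *)
Lemma quad1 i j :
  \sum_k \sum_l \sum_m \sum_q H k l * H m q * (T i k q * T' j l m)
  = tau ^+ 2 * (c * r * H j i + w i * z j * ((n%:R - 1) * h ^+ 2 - c ^+ 2)).
Proof.
transitivity (\sum_k tau ^+ 2 * (c * H j i * (w k * z k) - c * w i * (H j k * z k)
   - z j * (w k * (h * H k i + c * s * (z k * w i))) + w i * z j * (h * H k k
     + c * s * (w k * z k)))).
  apply: eq_bigr => k _.
  transitivity (\sum_l H k l * (tau ^+ 2 * (w k * H j i - w i * H j k) * z l +
     - (tau ^+ 2) * (z j * w k * H l i - z j * w i * H l k))).
    apply: eq_bigr => l _.
    transitivity (\sum_m (z l * kron j m - z j * kron l m) * (H k l * tau ^+ 2 * (w k * H m i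
      - w i * H m k))).
      apply: eq_bigr => m _.
      transitivity (\sum_q H m q * ((H k l * tau ^+ 2 * (z l * kron j m - z j * kron l m))
        * w k * kron i q
         + (- (H k l * tau ^+ 2 * (z l * kron j m - z j * kron l m)) * w i) * kron k q)).
        by apply: eq_bigr => q _; rewrite /T /T' /tors /torsbar; ring.
      by rewrite sum_lin !sum_kronr; ring.
    transitivity (\sum_m (H k l * tau ^+ 2 * (w k * H m i - w i * H m k)) * (z l * kron j m
      + (- z j) * kron l m)).
      by apply: eq_bigr => m _; ring.
    by rewrite sum_lin !sum_kronr; ring.
  rewrite sum_lin rk1_z.
  transitivity (tau ^+ 2 * (w k * H j i - w i * H j k) * (c * z k) + (- tau ^+ 2) *
     (\sum_l H k l * (z j * w k * H l i + (- z j * w i) * H l k))).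
    by congr (_ + _ * _); apply: eq_bigr => l _; ring.
  by rewrite sum_lin !rk1_sqr; ring.
rewrite -mulr_sumr; congr (_ * _).
transitivity (\sum_k (c * H j i * (w k * z k) - c * w i * (H j k * z k)
   - z j * h * (w k * H k i) - z j * c * s * w i * (w k * z k) + w i * z j * h * H k k
   + w i * z j * c * s * (w k * z k))).
  by apply: eq_bigr => k _; ring.
rewrite !big_split /= !sumrN -!mulr_sumr rk1_z rk1_w rk1_tr -/r /c.
by ring.
Qed.

Lemma quad2 i j :
  \sum_k \sum_l \sum_m \sum_q H k l * H m q * (T k m j * T' l q i)
  = tau ^+ 2 * (2 * c * (r * H j i - c * (w i * z j))).
Proof.
transitivity (\sum_k tau ^+ 2 * (c * r * H k i * kron j k - c ^+ 2 * w i * (z k * kron j k)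
   - c * z j * (w k * H k i) + c * H j i * (w k * z k))).
  apply: eq_bigr => k _.
  transitivity (\sum_l H k l * ((tau ^+ 2 * (c * r * kron j k - c * z j * w k)) * kron i l +
     (tau ^+ 2 * (w k * H j i - c * w i * kron j k)) * z l)).
    apply: eq_bigr => l _.
    transitivity (\sum_m (w m * kron k j - w k * kron m j) *
        (tau ^+ 2 * H k l * c * kron i l * z m + (- (tau ^+ 2 * H k l * z l)) * H m i)).
      apply: eq_bigr => m _.
      transitivity (\sum_q H m q * ((H k l * tau ^+ 2 * (w m * kron k j - w k * kron m j)
        * kron l i) * z q
         + (- (H k l * tau ^+ 2 * (w m * kron k j - w k * kron m j)) * z l) * kron i q)).
        by apply: eq_bigr => q _; rewrite /T /T' /tors /torsbar [kron q i]kronC; ring.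
      by rewrite sum_lin !sum_kronr rk1_z [kron l i]kronC; ring.
    rewrite sum_lin.
    have -> : \sum_m (w m * kron k j - w k * kron m j) * z m = kron j k * r - w k * z j.
      transitivity (\sum_m (kron j k * (w m * z m) - w k * (z m * kron m j))).
        by apply: eq_bigr => m _; rewrite [kron k j]kronC; ring.
      by rewrite big_split /= sumrN -!mulr_sumr sum_kronr_sym.
    have -> : \sum_m (w m * kron k j - w k * kron m j) * H m i = kron j k * c * w i
      - w k * H j i.
      transitivity (\sum_m (kron j k * (w m * H m i) - w k * (H m i * kron m j))).
        by apply: eq_bigr => m _; rewrite [kron k j]kronC; ring.
      by rewrite big_split /= sumrN -!mulr_sumr sum_kronr_sym rk1_w mulrA.
    by ring.
  by rewrite sum_lin !sum_kronr rk1_z; ring.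
rewrite -mulr_sumr; congr (_ * _).
rewrite !big_split /= !sumrN -!mulr_sumr.
transitivity (c * r * H j i - c ^+ 2 * w i * z j - c * z j * (c * w i) + c * H j i * r).
  congr (_ - _ - _ + _); [|by rewrite sum_kronr|by rewrite rk1_w].
  transitivity (\sum_k (c * r * H k i) * kron j k); first by apply: eq_bigr.
  by rewrite sum_kronr.
by ring.
Qed.

(** Both torsions are contracted separately: a product of two traces. *)
Lemma quad3 i j :
  \sum_k \sum_l \sum_m \sum_q H k l * H m q * (T i k l * T' j q m)
  = tau ^+ 2 * ((n%:R - 1) ^+ 2 * h ^+ 2 * (w i * z j)).
Proof.
transitivity ((\sum_k \sum_l H k l * T i k l) * (\sum_m \sum_q H m q * T' j q m)).
  rewrite mulr_suml; apply: eq_bigr => k _; rewrite mulr_suml; apply: eq_bigr => l _.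
  rewrite mulr_sumr; apply: eq_bigr => m _; rewrite mulr_sumr; apply: eq_bigr => q _.
  by ring.
by rewrite tors_trace torsbar_trace; ring.
Qed.

(** The sum over k, l is a trace of the torsion, proportional to a radial
vector, which is an eigenvector for the remaining contraction. *)
Lemma quad4 i j :
  \sum_k \sum_l \sum_m \sum_q H k l * H m q * (T m k l * T' q j i + T m i j * T' q l k)
  = 2 * tau ^+ 2 * ((n%:R - 1) * h * c * (r * kron i j - w i * z j)).
Proof.
transitivity (\sum_m \sum_q (H m q * T' q j i * (\sum_k \sum_l H k l * T m k l)
   + H m q * T m i j * (\sum_k \sum_l H k l * T' q l k))).
  transitivity (\sum_m \sum_q \sum_k \sum_l H k l * H m q * (T m k l * T' q j i
    + T m i j * T' q l k)).
    under eq_bigr => k _ do rewrite exchange_big.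
    rewrite exchange_big; apply: eq_bigr => m _.
    under eq_bigr => k _ do rewrite exchange_big.
    by rewrite exchange_big.
  apply: eq_bigr => m _; apply: eq_bigr => q _.
  rewrite !mulr_sumr -big_split; apply: eq_bigr => k _ /=.
  by rewrite !mulr_sumr -big_split; apply: eq_bigr => l _ /=; ring.
transitivity (\sum_m \sum_q - ((n%:R - 1) * h * tau) * (w m * H m q * T' q j i
  + H m q * z q * T m i j)).
  by apply: eq_bigr => m _; apply: eq_bigr => q _; rewrite tors_trace torsbar_trace; ring.
transitivity (- ((n%:R - 1) * h * tau) * (\sum_q c * w q * T' q j i
  + \sum_m c * z m * T m i j)).
  transitivity (- ((n%:R - 1) * h * tau) * (\sum_m \sum_q w m * H m q * T' q j i
    + \sum_m \sum_q H m q * z q * T m i j)).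
    rewrite -big_split mulr_sumr; apply: eq_bigr => m _ /=.
    by rewrite -big_split mulr_sumr; apply: eq_bigr => q _.
  congr (_ * (_ + _)).
    rewrite exchange_big; apply: eq_bigr => q _; rewrite -mulr_suml rk1_w; ring.
  by apply: eq_bigr => m _; rewrite -mulr_suml rk1_z.
have -> : \sum_q c * w q * T' q j i = c * tau * (z j * w i - r * kron i j).
  transitivity (\sum_q (c * tau * z j * (w q * kron q i) - c * tau * kron i j * (w q * z q))).
    by apply: eq_bigr => q _; rewrite /T' /torsbar [kron j i]kronC; ring.
  by rewrite big_split /= sumrN -!mulr_sumr sum_kronr_sym -/r; ring.
have -> : \sum_m c * z m * T m i j = c * tau * (z j * w i - r * kron i j).
  transitivity (\sum_m (c * tau * w i * (z m * kron m j) - c * tau * kron i j * (w m * z m))).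
    by apply: eq_bigr => q _; rewrite /T /tors; ring.
  by rewrite big_split /= sumrN -!mulr_sumr sum_kronr_sym -/r; ring.
by ring.
Qed.

End Inverse.
End Contraction.

(** * Algebra of the invariant metrics at a point *)

Section HopfAlgebra.
Variables (F : fieldType) (n : nat) (z w : 'I_n -> F) (rho x y : F).
Hypotheses (rho0 : rho != 0) (x0 : x != 0) (y0 : y != 0).
Hypothesis sum_wz : \sum_k w k * z k = rho^-1.
Implicit Types i j k l m e : 'I_n.
Local Notation kron := (@kron F n).

(** The metric (1/r) (x q + y P), with r = 1 / rho and P = rho w z. *)
Definition hopf_g i j := rho * x * kron i j + (y - x) * rho ^+ 2 * (w i * z j).
Definition hopf_q i j := kron i j - rho * (w i * z j).
(** The inverse metric g^(k bar l), which is r / x on the orthogonal of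
the radial direction and r / y on it. *)
Definition hopf_inv i j := rk1 z w (rho^-1 / x) (y^-1 - x^-1) i j.
Let u := y / x.
(** The holomorphic symbols Gamma_(ij)^k of the Chern connection.  The
lowered Bismut symbol Gamma_(ij bar k) is the derivative of g_(i bar k) along
z_j, so the Bismut symbols of this type are obtained by exchanging i and j. *)
Definition chern_G i j k := rho * (- (w i * kron j k) + (u - 1) * (w j * kron i k)
  - (u - 1) * rho * (w i * w j * z k)).
(** The Bismut symbols with one antiholomorphic direction: the component
along d/dz_k of the derivative of d/dz_j along d/d(bar z_i). *)
Definition bismut_G i j k := rho * (z k * kron i j - u * (z i * kron j k)
  + (u - 1) * rho * (z i * w j * z k)).
Definition bismut_Gbar i j k := rho * (w k * kron i j - u * (w i * kron j k)
  + (u - 1) * rho * (w i * z j * w k)).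

Lemma hopf_g_z l : \sum_e z e * hopf_g e l = rho * y * z l.
Proof.
transitivity (\sum_e (rho * x * (z e * kron e l) + (y - x) * rho ^+ 2 * z l * (w e * z e))).
  by apply: eq_bigr => e _; rewrite /hopf_g; ring.
by rewrite big_split /= -!mulr_sumr sum_wz sum_kronr_sym; field.
Qed.

Lemma hopf_g_w j : \sum_e hopf_g j e * w e = rho * y * w j.
Proof.
transitivity (\sum_e (rho * x * (kron j e * w e) + (y - x) * rho ^+ 2 * w j * (w e * z e))).
  by apply: eq_bigr => e _; rewrite /hopf_g; ring.
by rewrite big_split /= -!mulr_sumr sum_wz sum_kronl; field.
Qed.

Lemma hopf_q_g i l : \sum_m hopf_q i m * hopf_g m l = rho * x * hopf_q i l.
Proof.
transitivity (\sum_m (kron i m * hopf_g m l - rho * w i * (z m * hopf_g m l))).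
  by apply: eq_bigr => m _; rewrite /hopf_q; ring.
rewrite big_split /= sumrN -mulr_sumr sum_kronl hopf_g_z /hopf_g /hopf_q; ring.
Qed.

Lemma hopf_q_idem i l : \sum_m hopf_q i m * hopf_q m l = hopf_q i l.
Proof.
transitivity (\sum_m (kron i m * hopf_q m l - rho * w i * (z m * kron m l)
  + rho ^+ 2 * w i * z l * (w m * z m))).
  by apply: eq_bigr => m _; rewrite /hopf_q; ring.
rewrite !big_split /= sumrN -!mulr_sumr sum_kronl sum_kronr_sym sum_wz /hopf_q; field.
by [].
Qed.

Lemma hopf_inverse j k : \sum_l hopf_g j l * hopf_inv k l = kron j k.
Proof.
transitivity (\sum_l hopf_inv k l * ((rho * x) * kron j l + ((y - x) * rho ^+ 2 * w j) * z l)).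
  by apply: eq_bigr => l _; rewrite /hopf_g; ring.
rewrite sum_lin sum_kronr /hopf_inv rk1_z sum_wz /rk1 [kron k j]kronC.
by field; rewrite rho0 x0 y0.
Qed.

Lemma tors_chern i j k :
  \sum_e (chern_G i j e - chern_G j i e) * hopf_g e k = tors w (y * rho ^+ 2) i j k.
Proof.
transitivity (\sum_e (rho * u * w j * (kron i e * hopf_g e k)
  - rho * u * w i * (kron j e * hopf_g e k))).
  by apply: eq_bigr => e _; rewrite /chern_G; ring.
rewrite big_split /= sumrN -!mulr_sumr !sum_kronl /hopf_g /tors /u; field.
by [].
Qed.

(** The derivative of g_(j bar l) along z_i. *)
Definition dhopf_g i j l := - (rho ^+ 2 * w i) * (x * kron j l)
  + (y - x) * (- 2 * rho ^+ 3 * w i * (w j * z l) + rho ^+ 2 * (w j * kron i l)).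

Lemma chern_compat i j l : \sum_e chern_G i j e * hopf_g e l = dhopf_g i j l.
Proof.
transitivity (\sum_e (- (rho * w i) * (kron j e * hopf_g e l)
  + rho * (u - 1) * w j * (kron i e * hopf_g e l)
  - (u - 1) * rho ^+ 2 * w i * w j * (z e * hopf_g e l))).
  by apply: eq_bigr => e _; rewrite /chern_G; ring.
rewrite !big_split /= sumrN -!mulr_sumr !sum_kronl hopf_g_z /hopf_g /dhopf_g /u; field.
by [].
Qed.

Lemma bismut_compat i j l :
  \sum_e (chern_G j i e * hopf_g e l + bismut_Gbar i l e * hopf_g j e) = dhopf_g i j l.
Proof.
rewrite big_split /= chern_compat.
transitivity (dhopf_g j i l + \sum_e (rho * (kron i l + (u - 1) * rho * w i * z l)
  * (hopf_g j e * w e)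
  + (- (rho * u * w i)) * (hopf_g j e * kron l e))).
  by congr (_ + _); apply: eq_bigr => e _; rewrite /bismut_Gbar; ring.
rewrite big_split /= -!mulr_sumr sum_kronr hopf_g_w /hopf_g /dhopf_g /u; field.
by [].
Qed.

(** Total skew-symmetry of the Bismut torsion is the agreement, up to
sign, of this expression with the one of [tors_chern]. *)
Lemma bismut_tors i l j :
  \sum_e bismut_Gbar i l e * hopf_g j e = tors w (y * rho ^+ 2) i j l.
Proof.
have := bismut_compat i j l; rewrite big_split /= chern_compat => /eqP.
rewrite -subr_eq0 => /eqP H; apply/eqP; rewrite -subr_eq0; apply/eqP.
by rewrite -[RHS]H /dhopf_g /tors; ring.
Qed.

(** The derivation of [chern_G] along which rho, z_m and w_m have the
derivatives dr, dz m and dw m; likewise for [dbismut_G]. *)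
Definition dchern_G dr (dz dw : 'I_n -> F) i j k :=
  dr * (- (w i * kron j k) + (u - 1) * (w j * kron i k)
  - 2 * (u - 1) * rho * (w i * w j * z k))
  + rho * (- (dw i * kron j k) + (u - 1) * (dw j * kron i k)
  - (u - 1) * rho * (dw i * w j * z k + w i * dw j * z k + w i * w j * dz k)).
Definition dbismut_G dr (dz dw : 'I_n -> F) i j k :=
  dr * (z k * kron i j - u * (z i * kron j k) + 2 * (u - 1) * rho * (z i * w j * z k))
  + rho * (dz k * kron i j - u * (dz i * kron j k)
  + (u - 1) * rho * (dz i * w j * z k + z i * dw j * z k + z i * w j * dz k)).

Let zero_vec := fun _ : 'I_n => 0 : F.

Lemma chernT i j k : chern_G j i k =
  w j * (rho * (- kron i k - (u - 1) * rho * (w i * z k))) + rho * (u - 1) * w i * kron j k.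
Proof. by rewrite /chern_G; ring. Qed.

Lemma bismutT i j k : bismut_G i j k =
  rho * (kron i j + (u - 1) * rho * (z i * w j)) * z k + (- (rho * u * z i)) * kron j k.
Proof. by rewrite /bismut_G; ring. Qed.

Lemma sum_chern_chern i j k m :
  \sum_e chern_G k j e * chern_G e i m =
  w k * (rho * (- kron i m - (u - 1) * rho * (w i * z m))) * (- (rho * u * w j))
  + rho * (u - 1) * w i * (w k * (rho * (- kron j m - (u - 1) * rho * (w j * z m))))
  + rho * (u - 1) * w j * (w k * (rho * (- kron i m - (u - 1) * rho * (w i * z m))))
  + rho * (u - 1) * w i * (rho * (u - 1) * w j) * kron k m.
Proof.
transitivity (\sum_e (w k * (rho * (- kron j e - (u - 1) * rho * (w j * z e))) + rho * (u - 1)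
  * w j * kron k e)
 * (w e * (rho * (- kron i m - (u - 1) * rho * (w i * z m))) + rho * (u - 1) * w i * kron e m)).
  by apply: eq_bigr => e _; rewrite !chernT.
rewrite (sum_rank1 w (fun e => rho * (- kron j e - (u - 1) * rho * (w j * z e))) w
  (fun m => rho * (- kron i m - (u - 1) * rho * (w i * z m)))).
congr (_ * _ + _ + _ + _).
transitivity (\sum_e (- rho * (kron j e * w e) - (u - 1) * rho ^+ 2 * w j * (w e * z e))).
  by apply: eq_bigr => e _; ring.
by rewrite big_split /= sumrN -!mulr_sumr sum_kronl sum_wz; field.
Qed.

Lemma sum_bismut_bismut i j k m :
  \sum_e bismut_G j k e * bismut_G i e m =
  rho * (kron j k + (u - 1) * rho * (z j * w k)) * z m * (rho * u * z i)
  + (- (rho * u * z i)) * (rho * (kron j k + (u - 1) * rho * (z j * w k)) * z m)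
  + (- (rho * u * z j)) * (rho * (kron i k + (u - 1) * rho * (z i * w k)) * z m)
  + (- (rho * u * z j)) * (- (rho * u * z i)) * kron k m.
Proof.
transitivity (\sum_e (rho * (kron j k + (u - 1) * rho * (z j * w k)) * z e
  + (- (rho * u * z j)) * kron k e)
 * (rho * (kron i e + (u - 1) * rho * (z i * w e)) * z m + (- (rho * u * z i)) * kron e m)).
  by apply: eq_bigr => e _; rewrite !bismutT.
rewrite (sum_rank1 (fun k => rho * (kron j k + (u - 1) * rho * (z j * w k))) z
  (fun e => rho * (kron i e + (u - 1) * rho * (z i * w e))) z).
congr (_ * _ + _ + _ + _); last by ring.
transitivity (\sum_e (rho * (kron i e * z e) + (u - 1) * rho ^+ 2 * z i * (w e * z e))).
  by apply: eq_bigr => e _; ring.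
by rewrite big_split /= -!mulr_sumr sum_kronl sum_wz; field.
Qed.

Lemma sum_bismut_chern i j k m :
  \sum_e bismut_G j k e * chern_G e i m =
  rho * (kron j k + (u - 1) * rho * (z j * w k)) * (rho * (- kron i m - (u - 1)
    * rho * (w i * z m))) * rho^-1
  + rho * (u - 1) * w i * (rho * (kron j k + (u - 1) * rho * (z j * w k)) * z m)
  + (- (rho * u * z j)) * (w k * (rho * (- kron i m - (u - 1) * rho * (w i * z m))))
  + (rho * (u - 1) * w i) * (- (rho * u * z j)) * kron k m.
Proof.
transitivity (\sum_e (rho * (kron j k + (u - 1) * rho * (z j * w k)) * z e
  + (- (rho * u * z j)) * kron k e)
 * (w e * (rho * (- kron i m - (u - 1) * rho * (w i * z m))) + rho * (u - 1) * w i * kron e m)).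
  by apply: eq_bigr => e _; rewrite bismutT chernT.
rewrite (sum_rank1 (fun k => rho * (kron j k + (u - 1) * rho * (z j * w k))) z w
  (fun m => rho * (- kron i m - (u - 1) * rho * (w i * z m)))).
congr (_ * _ + _ + _ + _).
by rewrite -sum_wz; apply: eq_bigr => e _; rewrite mulrC.
Qed.

Lemma sum_chern_bismut i j k m :
  \sum_e chern_G k i e * bismut_G j e m =
  w k * z m * (- (rho ^+ 2) * (kron i j + (u ^+ 2 - 1) * rho * (w i * z j)))
  + (- (rho * u * z j)) * (w k * (rho * (- kron i m - (u - 1) * rho * (w i * z m))))
  + rho * (u - 1) * w i * (rho * (kron j k + (u - 1) * rho * (z j * w k)) * z m)
  + (rho * (u - 1) * w i) * (- (rho * u * z j)) * kron k m.
Proof.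
transitivity (\sum_e (w k * (rho * (- kron i e - (u - 1) * rho * (w i * z e))) + rho * (u - 1)
  * w i * kron k e)
 * (rho * (kron j e + (u - 1) * rho * (z j * w e)) * z m + (- (rho * u * z j)) * kron e m)).
  by apply: eq_bigr => e _; rewrite bismutT chernT.
rewrite (sum_rank1 w (fun e => rho * (- kron i e - (u - 1) * rho * (w i * z e)))
  (fun e => rho * (kron j e + (u - 1) * rho * (z j * w e))) z).
congr (_ * _ + _ + _ + _); last by ring.
transitivity (\sum_e (- (rho ^+ 2) * (kron i e * kron j e)
  - (u - 1) * rho ^+ 3 * z j * (kron i e * w e) - (u - 1) * rho ^+ 3 * w i * (kron j e * z e)
  - (u - 1) ^+ 2 * rho ^+ 4 * w i * z j * (w e * z e))).
  by apply: eq_bigr => e _; ring.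
rewrite !big_split /= !sumrN -!mulr_sumr !sum_kronl sum_wz [kron j i]kronC; field.
by [].
Qed.

(** The (1,1) part of the Bismut curvature, as an endomorphism
of the holomorphic tangent space. *)
Lemma bismut_curv_mixed i j k m :
  dbismut_G (- (rho ^+ 2 * w i)) (fun l => kron i l) zero_vec j k m
  - dchern_G (- (rho ^+ 2 * z j)) zero_vec (fun l => kron j l) k i m
  + \sum_e (bismut_G j k e * chern_G e i m - chern_G k i e * bismut_G j e m)
  = rho * (hopf_q i m * hopf_q k j - (2 * u - 1) * (hopf_q i j * hopf_q k m)).
Proof.
rewrite big_split /= sumrN sum_bismut_chern sum_chern_bismut.
rewrite /dbismut_G /dchern_G /zero_vec /hopf_q [kron j i]kronC [kron k j]kronC.
by field.
Qed.

(** The (2,0) part vanishes. *)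
Lemma bismut_curv_hol i j k m :
  dchern_G (- (rho ^+ 2 * w i)) (fun l => kron i l) zero_vec k j m
  - dchern_G (- (rho ^+ 2 * w j)) (fun l => kron j l) zero_vec k i m
  + \sum_e (chern_G k j e * chern_G e i m - chern_G k i e * chern_G e j m) = 0.
Proof.
rewrite big_split /= sumrN !sum_chern_chern /dchern_G /zero_vec; ring.
Qed.

(** The (0,2) part vanishes. *)
Lemma bismut_curv_anti i j k m :
  dbismut_G (- (rho ^+ 2 * z i)) zero_vec (fun l => kron i l) j k m
  - dbismut_G (- (rho ^+ 2 * z j)) zero_vec (fun l => kron j l) i k m
  + \sum_e (bismut_G j k e * bismut_G i e m - bismut_G i k e * bismut_G j e m) = 0.
Proof.
rewrite big_split /= sumrN !sum_bismut_bismut /dbismut_G /zero_vec; ring.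
Qed.

(** The Chern symbols with an antiholomorphic index vanish, so that
the Chern curvature is minus an antiholomorphic derivative of [chern_G]. *)
Lemma chern_ricci i j :
  \sum_k \sum_l hopf_inv k l * \sum_e
     (- dchern_G (- (rho ^+ 2 * z l)) zero_vec (fun m => kron l m) k i e) * hopf_g e j
  = rho * ((n%:R - u) * hopf_q i j + (n%:R - 1) * u ^+ 2 * (rho * (w i * z j))).
Proof.
transitivity (\sum_e (\sum_k \sum_l hopf_inv k l *
     (- dchern_G (- (rho ^+ 2 * z l)) zero_vec (fun m => kron l m) k i e)) * hopf_g e j).
  under eq_bigr => k _ do under eq_bigr => l _ do rewrite mulr_sumr.
  under eq_bigr => k _ do rewrite exchange_big.
  rewrite exchange_big; apply: eq_bigr => e _.
  by rewrite mulr_suml; apply: eq_bigr => k _; rewrite mulr_suml; apply: eq_bigr => l _;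
    rewrite mulrA.
transitivity (\sum_e ((n%:R - u) / x * kron i e + (n%:R * (u - 1) / x) * (rho * w i * z e))
  * hopf_g e j).
  apply: eq_bigr => e _; congr (_ * _).
  set h := rho^-1 / x; set s := y^-1 - x^-1.
  transitivity (\sum_k ((h + s * rho^-1) * (- (rho ^+ 2 * kron i e) - 2 * (u - 1)
    * rho ^+ 3 * (w i * z e)) * (w k * z k)
     + (h + s * rho^-1) * rho ^+ 2 * (u - 1) * w i * (kron e k * z k)
     + rho * (kron i e + (u - 1) * rho * w i * z e) * hopf_inv k k
     + (- (rho * (u - 1))) * (hopf_inv k i * kron e k)
     + rho ^+ 2 * (u - 1) * z e * (w k * hopf_inv k i))).
    apply: eq_bigr => k _.
    transitivity (\sum_l hopf_inv k l *
       (((rho ^+ 2 * (- (w k * kron i e) + (u - 1) * (w i * kron k e)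
          - 2 * (u - 1) * rho * (w k * w i * z e)))) * z l
       + 1 * ((rho * kron i e + (u - 1) * rho ^+ 2 * w i * z e) * kron k l
          + (- rho * (u - 1) * kron k e + (u - 1) * rho ^+ 2 * w k * z e) * kron i l))).
      by apply: eq_bigr => l _; rewrite /dchern_G /zero_vec [kron l k]kronC [kron l i]kronC;
        ring.
    rewrite sum_lin sum_lin !sum_kronr /hopf_inv rk1_z sum_wz -/h -/s [kron k e]kronC.
    by ring.
  rewrite !big_split /= -!mulr_sumr sum_kronl sum_kronr sum_wz /hopf_inv rk1_tr rk1_w sum_wz
    /rk1.
  rewrite /h /s /u [kron e i]kronC; field.
  by rewrite rho0 x0 y0.
transitivity (\sum_e ((n%:R - u) / x * (kron i e * hopf_g e j) + (n%:R * (u - 1) / x)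
  * rho * w i * (z e * hopf_g e j))).
  by apply: eq_bigr => e _; ring.
rewrite big_split /= -!mulr_sumr sum_kronl hopf_g_z /hopf_g /hopf_q /u; field.
by rewrite x0.
Qed.

(** The right-hand side of the flow, with S and the Q^i in the form
given by [chern_ricci] and [quad1] to [quad4]. *)
Lemma hcf_identity (a b c d : F) i j (two0 : (2 : F) != 0) :
  let h := rho^-1 / x in let s := y^-1 - x^-1 in let r := \sum_k w k * z k in
  let e := h + s * r in let tau := y * rho ^+ 2 in
  - (rho * ((n%:R - u) * hopf_q i j + (n%:R - 1) * u ^+ 2 * (rho * (w i * z j))))
  + a * (tau ^+ 2 * (e * r * hopf_inv j i + w i * z j * ((n%:R - 1) * h ^+ 2 - e ^+ 2)))
  + b * (tau ^+ 2 * (2 * e * (r * hopf_inv j i - e * (w i * z j))))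
  + c * (tau ^+ 2 * ((n%:R - 1) ^+ 2 * h ^+ 2 * (w i * z j)))
  + d * (2^-1 * (2 * tau ^+ 2 * ((n%:R - 1) * h * e * (r * kron i j - w i * z j))))
  = rho * ((- n%:R + u * (1 + a + 2 * b + (n%:R - 1) * d)) * hopf_q i j
      + (u ^+ 2 * ((n%:R - 1) * (a - 1) + (n%:R - 1) ^+ 2 * c)) * (rho * (w i * z j))).
Proof.
move=> h s r e tau; rewrite /tau /e /s /r /h sum_wz /hopf_inv /rk1 /hopf_q /u [kron j i]kronC.
by field; rewrite two0 rho0 x0 y0.
Qed.

End HopfAlgebra.

(** * Hermitian connections from their holomorphic symbols *)

Section Connections.
Context {R : realType} {n : nat}.
Local Notation C := R[i].
Local Notation Cn := (Cn R n).
Local Notation idx := (@idx n).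
Local Notation sm := (smooth (@punctured R n)).
Implicit Types (A B D E : idx) (p : Cn) (g : @metric_field R n) (Gam : @christoffel R n).

Lemma big_idx (f : idx -> C) : \sum_E f E = \sum_k f (inl k) + \sum_k f (inr k).
Proof. exact: big_sumType. Qed.

Lemma gc_sym g A B p : gc g A B p = gc g B A p.
Proof. by case: A; case: B. Qed.

Lemma gc_bar g A B p : is_hermitian_metric g -> punctured p ->
  gc g (bar A) (bar B) p = conjc (gc g A B p).
Proof.
move=> [_ H] Pp; have [hg _] := H p Pp.
by case: A => i; case: B => j; rewrite /gc /bar ?conjc0 // hg ?conjcK.
Qed.

Lemma barred_bar A : barred (bar A) = ~~ barred A. Proof. by case: A. Qed.

Lemma sum_bar (f : idx -> C) : \sum_E f (bar E) = \sum_E f E.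
Proof. by rewrite !big_idx addrC. Qed.

Section TypePreserving.
Variables (G1 G2 : 'I_n -> 'I_n -> 'I_n -> Cn -> C).

(** A real connection that preserves J is determined by its symbols on the
holomorphic tangent space, one family for each type of direction. *)
Definition conn : @christoffel R n := fun A B D p =>
  match A, B, D with
  | inl i, inl j, inl k => G1 i j k p
  | inr i, inl j, inl k => G2 i j k p
  | inr i, inr j, inr k => conjc (G1 i j k p)
  | inl i, inr j, inr k => conjc (G2 i j k p)
  | _, _, _ => 0
  end.

Lemma conn_bar A B D p : conn (bar A) (bar B) (bar D) p = conjc (conn A B D p).
Proof. by case: A; case: B; case: D => *; rewrite /conn /bar ?conjc0 ?conjcK. Qed.

Lemma conn0 A B D p : barred B != barred D -> conn A B D p = 0.
Proof. by case: A; case: B; case: D. Qed.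

Hypotheses (s1 : forall i j k, sm (G1 i j k)) (s2 : forall i j k, sm (G2 i j k)).

Lemma conn_smooth A B D : sm (conn A B D).
Proof.
have s0 : sm (fun=> 0) by exact: smooth_cst.
case: A => i; case: B => j; case: D => k; rewrite /conn //;
  by apply: smooth_conj; [exact: open_punctured|].
Qed.

(** Reality and the Hermitian symmetry of g reduce metric
compatibility to one type of indices. *)
Lemma conn_hermitian g : is_hermitian_metric g ->
  (forall i j l p, punctured p -> partial (inl i) (fun q => g q j l) p =
     \sum_e (G1 i j e p * g p e l + conjc (G2 i l e p) * g p j e)) ->
  hermitian_connection g conn.
Proof.
move=> hg compat; split.
- exact: conn_smooth.
- by move=> *; exact: conn_bar.
- have gs A B : sm (gc g A B).
    case: A => i; case: B => j; rewrite /gc; try exact: smooth_cst; exact: hg.1.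
  have Hlr i j l p : punctured p -> partial (inl i) (gc g (inl j) (inr l)) p =
    \sum_E (conn (inl i) (inl j) E p * gc g E (inr l) p
      + conn (inl i) (inr l) E p * gc g (inl j) E p).
    move=> Pp; rewrite [LHS]compat // big_idx big_split /=.
    by congr (_ + _); apply: eq_bigr => e _; rewrite mul0r ?addr0 ?add0r.
  have Hl i B D p : punctured p -> partial (inl i) (gc g B D) p =
      \sum_E (conn (inl i) B E p * gc g E D p + conn (inl i) D E p * gc g B E p).
    move=> Pp; case: B => j; case: D => l.
    - by rewrite partial_cst big1 // => -[] e _; rewrite /conn /gc !(mulr0, mul0r) addr0.
    - exact: Hlr.
    - rewrite (_ : gc g (inr j) (inl l) = gc g (inl l) (inr j)) // Hlr //.
      by apply: eq_bigr => E _; rewrite addrC [gc g E (inl l) p]gc_sym [gc g (inr j) E p]gc_sym.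
    by rewrite partial_cst big1 // => -[] e _; rewrite /conn /gc !(mulr0, mul0r) addr0.
  case=> i B D p Pp; first exact: Hl.
  rewrite (partial_ext (inr i) Pp (h := fun q => conjc (gc g (bar B) (bar D) q))); last first.
    by move=> q Pq; rewrite gc_bar // conjcK.
  rewrite (_ : inr i = bar (inl i)) // partial_conj // Hl // conjc_sum -[RHS]sum_bar.
  apply: eq_bigr => E _; rewrite conjcD !conjcM -!conn_bar -!gc_bar // !barK.
  by rewrite /bar; case: E.
- move=> A B D p _; have [e|/conn0 ->] := eqVneq (barred B) (barred D); last by rewrite !mulr0.
  by congr (_ * _); move: e; case: B; case: D.
Qed.

(** The torsion is real and antisymmetric in its first two arguments,
so total skew-symmetry reduces to the single mixed component. *)
Lemma conn_bismut g : is_hermitian_metric g ->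
  (forall i j l p, punctured p -> partial (inl i) (fun q => g q j l) p =
     \sum_e (G1 i j e p * g p e l + conjc (G2 i l e p) * g p j e)) ->
  (forall i j k p, punctured p ->
     \sum_e (G1 i j e p - G1 j i e p) * g p e k = - \sum_e conjc (G2 i k e p) * g p j e) ->
  bismut_connection g conn.
Proof.
move=> hg compat skew; split; first exact: conn_hermitian.
have tanti A B D p : torsion_low g conn A B D p = - torsion_low g conn B A D p.
  by rewrite -sumrN; apply: eq_bigr => E _; rewrite -mulNr opprB.
have tbar A B D p : punctured p ->
    torsion_low g conn (bar A) (bar B) (bar D) p = conjc (torsion_low g conn A B D p).
  move=> Pp; rewrite /torsion_low conjc_sum -[LHS]sum_bar; apply: eq_bigr => E _.
  by rewrite conjcM /torsion conjcD conjcN !conn_bar gc_bar.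
have t1 i j k p : torsion_low g conn (inl i) (inl j) (inr k) p =
    \sum_e (G1 i j e p - G1 j i e p) * g p e k.
  rewrite /torsion_low big_idx [X in _ + X]big1 ?addr0 // => e _.
  by rewrite /gc mulr0.
have t2 i j k p : torsion_low g conn (inl i) (inr j) (inl k) p =
    \sum_e conjc (G2 i j e p) * g p k e.
  rewrite /torsion_low big_idx [X in X + _]big1 ?add0r.
    by apply: eq_bigr => e _; rewrite /torsion /conn /gc subr0.
  by move=> e _; rewrite /gc mulr0.
have t0 i j k p : torsion_low g conn (inl i) (inl j) (inl k) p = 0.
  rewrite /torsion_low big1 // => -[] e _; first by rewrite /gc mulr0.
  by rewrite /torsion /conn subrr mul0r.
have Hl i B D p : punctured p -> torsion_low g conn (inl i) B D p =
  - torsion_low g conn (inl i) D B p.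
  move=> Pp; case: B => j; case: D => k.
  - by rewrite !t0 oppr0.
  - by rewrite t1 t2 skew.
  - by rewrite t1 t2 skew // opprK.
  have h j' k' : torsion_low g conn (inl i) (inr j') (inr k') p =
      conjc (\sum_e (G1 j' k' e p - G1 k' j' e p) * g p e i).
    rewrite skew // -t2 conjcN -tbar // tanti; congr (- _).
  rewrite !h -conjcN -sumrN; congr conjc; apply: eq_bigr => e _; by rewrite -mulNr opprB.
move=> A B D p Pp; split; first exact: tanti.
case: A => i; first exact: Hl.
rewrite -[B]barK -[D]barK (_ : inr i = bar (inl i)) // !tbar // Hl //.
by rewrite conjcN.
Qed.

Lemma conn_chern g : is_hermitian_metric g -> (forall i j k, G2 i j k = fun=> 0) ->
  (forall i j l p, punctured p -> partial (inl i) (fun q => g q j l) p =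
     \sum_e G1 i j e p * g p e l) ->
  chern_connection g conn.
Proof.
move=> hg G20 compat; split.
  apply: conn_hermitian => // i j l p Pp; rewrite compat //.
  by apply: eq_bigr => e _; rewrite G20 conjc0 mul0r addr0.
by move=> i j [] k p _; rewrite /torsion /conn G20 ?conjc0 subrr.
Qed.

End TypePreserving.

(** A Hermitian metric is nondegenerate, so tensors may be compared after
lowering an index. *)
Lemma gc_inj g p (f h : idx -> C) : is_hermitian_metric g -> punctured p ->
  (forall D, \sum_E f E * gc g E D p = \sum_E h E * gc g E D p) -> forall E, f E = h E.
Proof.
move=> hg Pp e; have [_ H] := hg; have [gH gpos] := H p Pp.
have nondeg (v : 'rV[C]_n) : (forall l, \sum_i v 0 i * g p i l = 0) -> v = 0.
  move=> v0; apply/eqP/negPn/negP => /gpos; rewrite exchange_big big1 ?ltxx // => l _.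
  rewrite (eq_bigr (fun i => conjc (v 0 l) * (v 0 i * g p i l))).
    by rewrite -mulr_sumr v0 mulr0.
  by move=> i _; rewrite mulrCA mulrA.
have d0 D : \sum_E (f E - h E) * gc g E D p = 0.
  rewrite (eq_bigr (fun E => f E * gc g E D p - h E * gc g E D p)).
    by rewrite big_split sumrN /= e subrr.
  by move=> E _; rewrite mulrBl.
case=> k; apply/eqP; rewrite -subr_eq0; apply/eqP.
  have := nondeg (\row_i (f (inl i) - h (inl i))) _ => /(_ _)/rowP/(_ k).
  rewrite !mxE; apply => l; have := d0 (inr l); rewrite big_idx [X in _ + X]big1 ?addr0.
    by move=> H0; rewrite -[RHS]H0; apply: eq_bigr => i _; rewrite mxE.
  by move=> i _; rewrite /gc mulr0.
have := nondeg (\row_i conjc (f (inr i) - h (inr i))) _ => /(_ _)/rowP/(_ k).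
rewrite !mxE => H0; apply/eqP; rewrite -conjc_eq0; apply/eqP; apply: H0 => l.
have := d0 (inl l); rewrite big_idx [X in X + _]big1 ?add0r.
  move=> /(congr1 conjc); rewrite conjc0 conjc_sum => H1; rewrite -[RHS]H1;
    apply: eq_bigr => i _.
  by rewrite mxE conjcM /gc gH.
by move=> i _; rewrite /gc mulr0.
Qed.

Lemma hermitian_conn0 g Gam A B D p : hermitian_connection g Gam -> punctured p ->
  barred B != barred D -> Gam A B D p = 0.
Proof.
move=> [_ _ _ J] Pp; have := J A B D p Pp => e ne; apply/eqP.
have i0 : (iC : C) + iC != 0 by rewrite /iC eq_complex /= addr0 eqxx /= -mulr2n mulrn_eq0
  oner_eq0.
move: e ne; case: B => j; case: D => k // e _.
  by move/eqP: e; rewrite /= mulNr -subr_eq0 opprK -mulrDl mulf_eq0 (negbTE i0).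
by move/eqP: e; rewrite /= mulNr eq_sym -subr_eq0 opprK -mulrDl mulf_eq0 (negbTE i0).
Qed.

(** Lower all indices and write L for the symbols.  Since J is
parallel, L A B D vanishes for B and D of the same type.  If A and B have the
same type and D the other one, skew-symmetry of the torsion and metric
compatibility give L B A D = d_A g(B, D); compatibility then gives the
remaining components. *)
Lemma bismut_unique g Gam Gam' A B D p : is_hermitian_metric g ->
  bismut_connection g Gam -> bismut_connection g Gam' -> punctured p ->
  Gam A B D p = Gam' A B D p.
Proof.
move=> hg b1 b2 Pp.
pose L (G : christoffel) A B D := \sum_E G A B E p * gc g E D p.
have Lo G A' B' D' : hermitian_connection g G -> barred B' = barred D' -> L G A' B' D' = 0.
  move=> hG e; rewrite /L big1 // => E _.
  have [eE|ne] := eqVneq (barred B') (barred E); last by rewrite (hermitian_conn0 _ hG) ?mul0r.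
  rewrite (_ : gc g E D' p = 0) ?mulr0 //; move: e; rewrite eE.
  by case: (E); case: (D').
have compat G A' B' D' : hermitian_connection g G ->
    partial A' (gc g B' D') p = L G A' B' D' + L G A' D' B'.
  move=> [_ _ h _]; rewrite h // big_split; congr (_ + _).
  by apply: eq_bigr => E _; rewrite [gc g B' E p]gc_sym.
have same G A' B' D' : bismut_connection g G -> barred A' = barred B'
  -> barred D' != barred A' ->
    L G B' A' D' = partial A' (gc g B' D') p.
  move=> [hG skew] eAB nDA.
  have tl X Y Z : torsion_low g G X Y Z p = L G X Y Z - L G Y X Z.
    rewrite /L -sumrN -big_split; apply: eq_bigr => E _ /=.
    by rewrite /torsion mulrBl.
  have [_] := skew A' B' D' p Pp; rewrite !tl (compat G) // (Lo G D' A' B') //.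
  move=> /(congr1 (fun t => L G A' B' D' - t)) => e.
  have : L G B' A' D' = L G A' B' D' - (L G A' B' D'
    - L G B' A' D') by rewrite opprB addrCA subrr addr0.
  by rewrite e => ->; rewrite subr0 opprK.
have LE A' B' D' : L Gam A' B' D' = L Gam' A' B' D'.
  have [eBD|nBD] := eqVneq (barred B') (barred D').
    by rewrite !Lo //; [exact: b2.1|exact: b1.1].
  have [eAB|nAB] := eqVneq (barred A') (barred B').
    by rewrite !same // -?eAB //; rewrite eq_sym // eAB.
  have eAD : barred A' = barred D'.
    by move: nBD nAB; case: (barred A'); case: (barred B'); case: (barred D').
  have h G : bismut_connection g G -> L G A' B' D' = partial A' (gc g B' D') p
    - partial D' (gc g A' B') p.
    move=> bG; rewrite (compat G) ?bG.1 //; last exact: bG.1.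
    by rewrite -(same G) // ?addrK // -eAD eq_sym.
  by rewrite !h.
by apply: (gc_inj (f := fun E => Gam A B E p) (h := fun E => Gam' A B E p) hg Pp) => E;
  exact: LE.
Qed.

Lemma eq_curvature Gam Gam' A B D E p : punctured p ->
  (forall A B D q, punctured q -> Gam A B D q = Gam' A B D q) ->
  curvature Gam A B D E p = curvature Gam' A B D E p.
Proof.
move=> Pp e; rewrite /curvature (partial_ext A Pp (h := Gam' B D E)); last by move=> q;
  exact: e.
rewrite (partial_ext B Pp (h := Gam' A D E)); last by move=> q; exact: e.
by under eq_bigr => F _ do rewrite !e //.
Qed.

Section ConnCurvature.
Variables (G1 G2 : 'I_n -> 'I_n -> 'I_n -> Cn -> C).
Hypotheses (s1 : forall i j k, sm (G1 i j k)) (s2 : forall i j k, sm (G2 i j k)).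
Let Gam := conn G1 G2.

Lemma curvature_bar A B D E p : punctured p ->
  curvature Gam (bar A) (bar B) (bar D) (bar E) p = conjc (curvature Gam A B D E p).
Proof.
move=> Pp; have cs := conn_smooth s1 s2.
have pb X Y Z W : partial (bar X) (Gam (bar Y) (bar Z) (bar W)) p
  = conjc (partial X (Gam Y Z W) p).
  rewrite -(partial_conj X (cs Y Z W) Pp).
  by apply: (partial_ext (bar X) Pp) => q _; exact: conn_bar.
rewrite /curvature !conjcD conjcN !pb conjc_sum; congr (_ + _); rewrite -[LHS]sum_bar.
by apply: eq_bigr => F _; rewrite conjcD conjcN !conjcM /Gam !conn_bar.
Qed.

Lemma curvature_conn0 A B D E p : barred D != barred E -> curvature Gam A B D E p = 0.
Proof.
move=> ne; rewrite /curvature.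
have z X : Gam X D E = fun=> 0 by apply/funext => q; exact: conn0.
rewrite !z !partial_cst subrr add0r big1 // => F _.
have [e|nF] := eqVneq (barred D) (barred F); last first.
  have c0 X : Gam X D F p = 0 by exact: conn0.
  by rewrite !c0 !mul0r subrr.
have c0 X : Gam X F E p = 0 by apply: conn0; rewrite -e.
by rewrite !c0 !mulr0 subrr.
Qed.

End ConnCurvature.
End Connections.

(** * The invariant Hopf metrics *)

Section HopfMetrics.
Context {R : realType} {n : nat}.
Local Notation C := R[i].
Local Notation Cn := (Cn R n).
Local Notation idx := (@idx n).
Local Notation sm := (smooth (@punctured R n)).
Local Notation kron := (@kron C n).
Implicit Types (A B D E : idx) (p : Cn) (x y : R) (i j k l m e : 'I_n).

Definition zc p k : C := zeta (inl k) p.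
Definition wc p k : C := zeta (inr k) p.

Lemma conj_zc p k : conjc (zc p k) = wc p k. Proof. by []. Qed.
Lemma conj_wc p k : conjc (wc p k) = zc p k. Proof. exact: conjcK. Qed.
Lemma conj_rho p : conjc (rho p) = rho p. Proof. by rewrite rhoE conjc_real. Qed.
Lemma conj_kron i j : conjc (kron i j) = kron i j. Proof. exact: conjc_nat. Qed.
Lemma sum_wc_zc p : \sum_k wc p k * zc p k = (rho p)^-1.
Proof. by rewrite /rho invrK; apply: eq_bigr => k _; rewrite mulrC. Qed.
Lemma rho_neq0 p : punctured p -> rho p != 0.
Proof. by move=> Pp; rewrite invr_eq0 normsq_neq0. Qed.
Lemma rho_gt0 p : punctured p -> 0 < rho p.
Proof. by move=> Pp; rewrite invr_gt0 normsq_gt0. Qed.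
Lemma realC_neq0 x : 0 < x -> x%:C != 0 :> C.
Proof. by move=> x0; rewrite eq_complex /= eqxx andbT gt_eqF. Qed.

Definition hopf x y : @metric_field R n := fun p =>
  \matrix_(i, j) hopf_g (zc p) (wc p) (rho p) x%:C y%:C i j.

Lemma hopfE x y p i j : hopf x y p i j = hopf_g (zc p) (wc p) (rho p) x%:C y%:C i j.
Proof. by rewrite mxE. Qed.

Definition dz A : 'I_n -> C := fun k => (A == inl k)%:R.
Definition dw A : 'I_n -> C := fun k => (A == inr k)%:R.
Definition dr A p : C := - (rho p ^+ 2 * zeta (bar A) p).

Lemma has_partials_zc k : has_partials (fun p => zc p k) (fun A _ => dz A k).
Proof. exact: has_partials_zeta. Qed.
Lemma has_partials_wc k : has_partials (fun p => wc p k) (fun A _ => dw A k).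
Proof. exact: has_partials_zeta. Qed.

Lemma dz_inl i : dz (inl i) = kron i. Proof. by []. Qed.
Lemma dw_inl i : dw (inl i) = fun=> 0. Proof. by []. Qed.
Lemma dr_inl i p : dr (inl i) p = - (rho p ^+ 2 * wc p i). Proof. by []. Qed.

Lemma has_partials_hopf_g (X Y : C) j l :
  has_partials (fun p => hopf_g (zc p) (wc p) (rho p) X Y j l)
   (fun A p => dr A p * (X * kron j l) + (Y - X) * (2 * rho p * dr A p * (wc p j * zc p l)
     + rho p ^+ 2 * (dw A j * zc p l + wc p j * dz A l))).
Proof.
have hr := (@has_partials_rho R n : has_partials _ dr).
have hw := has_partials_wc j; have hz := has_partials_zc l.
have := has_partialsD (has_partialsM hr (has_partials_cst (X * kron j l)))
  (has_partialsZ (Y - X) (has_partialsM (has_partialsM hr hr) (has_partialsM hw hz))).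
rewrite (_ : (fun p => hopf_g _ _ _ _ _ _ _) = (fun p => rho p * (X * kron j l) + (Y - X)
  * (rho p * rho p * (wc p j * zc p l)))).
  apply: has_partials_eq => A p _; move: (dr A p) (rho p) (wc p j) (zc p l) (dw A j) (dz A l)
    (kron j l).
  by move=> *; ring.
apply/funext => p; rewrite /hopf_g; move: (rho p) (wc p j) (zc p l) (kron j l) => *; ring.
Qed.

Lemma has_partials_chern (X Y : C) i j k :
  has_partials (fun p => chern_G (zc p) (wc p) (rho p) X Y i j k)
    (fun A p => dchern_G (zc p) (wc p) (rho p) X Y (dr A p) (dz A) (dw A) i j k).
Proof.
have hr := (@has_partials_rho R n : has_partials _ dr); pose g := Y / X - 1.
have hz := has_partials_zc k; have hi := has_partials_wc i; have hj := has_partials_wc j.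
have := has_partialsM hr (has_partialsB (has_partialsD (has_partialsN (has_partialsM hi
  (has_partials_cst (kron j k))))
  (has_partialsZ g (has_partialsM hj (has_partials_cst (kron i k)))))
  (has_partialsZ g (has_partialsM hr (has_partialsM (has_partialsM hi hj) hz)))).
rewrite (_ : (fun p => chern_G _ _ _ _ _ _ _ _) = (fun p => rho p * (- (wc p i * kron j k)
  + g * (wc p j * kron i k)
   - g * (rho p * (wc p i * wc p j * zc p k))))).
  apply: has_partials_eq => A p _; rewrite /dchern_G -/g.
  move: g (dr A p) (rho p) (wc p i) (wc p j) (zc p k) (dw A i) (dw A j) (dz A k) (kron j k)
    (kron i k).
  by move=> *; ring.
apply/funext => p; rewrite /chern_G -/g;
  move: g (rho p) (wc p i) (wc p j) (zc p k) (kron j k) (kron i k) => *; ring.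
Qed.

Lemma has_partials_bismut (X Y : C) i j k :
  has_partials (fun p => bismut_G (zc p) (wc p) (rho p) X Y i j k)
    (fun A p => dbismut_G (zc p) (wc p) (rho p) X Y (dr A p) (dz A) (dw A) i j k).
Proof.
have hr := (@has_partials_rho R n : has_partials _ dr); pose g := Y / X.
have hz := has_partials_zc k; have hi := has_partials_zc i; have hj := has_partials_wc j.
have := has_partialsM hr (has_partialsD (has_partialsB (has_partialsM hz (has_partials_cst
  (kron i j)))
  (has_partialsZ g (has_partialsM hi (has_partials_cst (kron j k)))))
  (has_partialsZ (g - 1) (has_partialsM hr (has_partialsM (has_partialsM hi hj) hz)))).
rewrite (_ : (fun p => bismut_G _ _ _ _ _ _ _ _) = (fun p => rho p * (zc p k * kron i j
  - g * (zc p i * kron j k)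
   + (g - 1) * (rho p * (zc p i * wc p j * zc p k))))).
  apply: has_partials_eq => A p _; rewrite /dbismut_G -/g.
  move: g (dr A p) (rho p) (zc p i) (wc p j) (zc p k) (dz A i) (dw A j) (dz A k) (kron j k)
    (kron i j).
  by move=> *; ring.
apply/funext => p; rewrite /bismut_G -/g;
  move: g (rho p) (zc p i) (wc p j) (zc p k) (kron j k) (kron i j) => *; ring.
Qed.

Lemma conj_bismut x y p i j k :
  conjc (bismut_G (zc p) (wc p) (rho p) x%:C y%:C i j k)
  = bismut_Gbar (zc p) (wc p) (rho p) x%:C y%:C i j k.
Proof.
rewrite /bismut_G /bismut_Gbar !(conjcM, conjcD, conjcN) !conj_rho !conj_zc !conj_wc !conj_kron.
by rewrite conjc_inv !conjc_real ?conjc1.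
Qed.

Lemma conj_hopf_q p i j : conjc (hopf_q (zc p) (wc p) (rho p) i j)
  = hopf_q (zc p) (wc p) (rho p) j i.
Proof. by rewrite /hopf_q !(conjcM, conjcD,
  conjcN) conj_rho conj_zc conj_wc conj_kron kronC [zc p i * _]mulrC. Qed.

Lemma conj_hopf x y p i j : hopf x y p j i = conjc (hopf x y p i j).
Proof.
rewrite !hopfE /hopf_g expr2 !(conjcM, conjcD,
  conjcN) !conj_rho conj_zc conj_wc conj_kron !conjc_real.
by rewrite kronC [zc p i * _]mulrC.
Qed.

(** The matrix q is a Hermitian idempotent, so its form is a sum of
squared moduli. *)
Lemma hopf_q_form p (v t : 'rV[C]_n) : punctured p ->
  \sum_i \sum_j hopf_q (zc p) (wc p) (rho p) i j * v 0 i * conjc (t 0 j)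
  = \sum_e (\sum_i v 0 i * hopf_q (zc p) (wc p) (rho p) i e)
       * conjc (\sum_i t 0 i * hopf_q (zc p) (wc p) (rho p) i e).
Proof.
move=> Pp; set q := hopf_q _ _ _.
transitivity (\sum_i \sum_j \sum_e (v 0 i * q i e) * conjc (t 0 j * q j e)).
  apply: eq_bigr => i _; apply: eq_bigr => j _.
  rewrite /q -(hopf_q_idem (rho_neq0 Pp) (sum_wc_zc p)) !mulr_suml; apply: eq_bigr => e _.
  rewrite conjcM conj_hopf_q.
  by move: (hopf_q _ _ _ i e) (hopf_q _ _ _ e j) (v 0 i) (conjc (t 0 j)) => *; ring.
under eq_bigr => i _ do rewrite exchange_big.
rewrite exchange_big; apply: eq_bigr => e _.
rewrite mulr_suml; apply: eq_bigr => i _.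
by rewrite conjc_sum mulr_sumr.
Qed.

Lemma form_mul_cross (Q : 'I_n -> 'I_n -> C) (a b a' b' : 'rV[C]_n) :
  (\sum_i \sum_j Q i j * a 0 i * conjc (b 0 j))
    * (\sum_i \sum_j Q i j * a' 0 i * conjc (b' 0 j))
  = \sum_i \sum_j \sum_k \sum_l Q i l * a 0 i * conjc (b 0 l)
    * (Q k j * a' 0 k * conjc (b' 0 j)).
Proof.
rewrite mulr_suml; apply: eq_bigr => i _.
rewrite [X in _ * X]exchange_big mulr_sumr; apply: eq_bigr => j _.
rewrite mulr_sumr; apply: eq_bigr => k _.
by rewrite mulr_suml.
Qed.

Lemma form_mul (Q : 'I_n -> 'I_n -> C) (a b a' b' : 'rV[C]_n) :
  (\sum_i \sum_j Q i j * a 0 i * conjc (b 0 j))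
    * (\sum_i \sum_j Q i j * a' 0 i * conjc (b' 0 j))
  = \sum_i \sum_j \sum_k \sum_l Q i j * a 0 i * conjc (b 0 j)
    * (Q k l * a' 0 k * conjc (b' 0 l)).
Proof.
rewrite mulr_suml; apply: eq_bigr => i _; rewrite mulr_suml; apply: eq_bigr => j _.
by rewrite mulr_sumr; apply: eq_bigr => k _; rewrite mulr_sumr.
Qed.

Lemma hopf_q_form_ge0 p (v : 'rV[C]_n) : punctured p ->
  0 <= \sum_i \sum_j hopf_q (zc p) (wc p) (rho p) i j * v 0 i * conjc (v 0 j).
Proof.
by move=> Pp; rewrite hopf_q_form //; apply: sumr_ge0 => e _; exact: mulcJ_ge0.
Qed.

Section FixedParameters.
Variables (x y : R) (x0 : 0 < x) (y0 : 0 < y).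
Local Notation X := (x%:C : C).
Local Notation Y := (y%:C : C).

(** The value at v is a positive combination of the q-form of v
and of |v.w|^2; these vanish only if the components q v and (v.w) z / r of v do. *)
Lemma hopf_hermitian : is_hermitian_metric (hopf x y).
Proof.
split.
  move=> i j; apply: smooth_ext (has_partials_hopf_g X Y i j).1; first exact: open_punctured.
  by move=> q _; rewrite hopfE.
move=> p Pp; split; first by move=> i j; exact: conj_hopf.
move=> v v0; set q := hopf_q (zc p) (wc p) (rho p).
pose s := \sum_i v 0 i * wc p i.
have -> : \sum_i \sum_j v 0 i * conjc (v 0 j) * hopf x y p i j =
  X * rho p * (\sum_i \sum_j q i j * v 0 i * conjc (v 0 j)) + Y * rho p ^+ 2 * (s * conjc s).
  rewrite mulr_sumr conjc_sum [s * _]mulr_suml mulr_sumr -big_split; apply: eq_bigr => i _ /=.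
  rewrite !mulr_sumr -big_split; apply: eq_bigr => j _ /=.
  rewrite hopfE /q /hopf_g /hopf_q conjcM conj_wc.
  by move: (rho p) (kron i j) (wc p i) (zc p j) (v 0 i) (conjc (v 0 j)) => *; ring.
have r0 := rho_gt0 Pp.
have X0 : 0 < X by rewrite ltcR. have Y0 : 0 < Y by rewrite ltcR.
rewrite lt_def addr_ge0 ?andbT; first last.
- by rewrite mulr_ge0 ?mulcJ_ge0 // mulr_ge0 ?exprn_ge0 // ltW.
- by rewrite mulr_ge0 ?hopf_q_form_ge0 // mulr_ge0 // ltW.
rewrite paddr_eq0; first last.
- by rewrite mulr_ge0 ?mulcJ_ge0 // mulr_ge0 ?exprn_ge0 // ltW.
- by rewrite mulr_ge0 ?hopf_q_form_ge0 // mulr_ge0 // ltW.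
apply: contra v0; rewrite !mulf_eq0 (gt_eqF X0) (gt_eqF Y0) (gt_eqF r0) /= conjc_eq0 orbb.
rewrite hopf_q_form // psumr_eq0; last by move=> e _; exact: mulcJ_ge0.
move=> /andP[/allP H /eqP s0]; apply/eqP/rowP => e; rewrite mxE.
have := H e (mem_index_enum e); rewrite mulf_eq0 conjc_eq0 orbb => /eqP.
have -> : \sum_i v 0 i * hopf_q (zc p) (wc p) (rho p) i e = v 0 e - rho p * zc p e * s.
  transitivity (\sum_i (v 0 i * kron i e - rho p * zc p e * (v 0 i * wc p i))).
    apply: eq_bigr => i _; rewrite /hopf_q.
    by move: (rho p) (kron i e) (wc p i) (zc p e) (v 0 i) => *; ring.
  by rewrite big_split /= sumrN -mulr_sumr sum_kronr_sym.
by rewrite s0 mulr0 subr0.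
Qed.

Definition hopf_chern := conn (fun i j k p => chern_G (zc p) (wc p) (rho p) X Y i j k) (fun _ _
  _ => fun=> 0).
Definition hopf_bismut := conn (fun i j k p => chern_G (zc p) (wc p) (rho p) X Y j i k)
  (fun i j k p => bismut_G (zc p) (wc p) (rho p) X Y i j k).

Lemma partial_hopf i j l p : punctured p ->
  partial (inl i) (fun q => hopf x y q j l) p = dhopf_g (zc p) (wc p) (rho p) X Y i j l.
Proof.
move=> Pp; rewrite (partial_ext (inl i) Pp (h := fun q => hopf_g (zc q) (wc q) (rho q) X Y j
  l)); last first.
  by move=> q _; rewrite hopfE.
rewrite (has_partials_hopf_g X Y j l).2 // dz_inl dw_inl dr_inl /dhopf_g.
move: (rho p) (kron i l) (kron j l) (wc p i) (wc p j) (zc p l) => *; ring.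
Qed.

Lemma hopf_chern_connection : chern_connection (hopf x y) hopf_chern.
Proof.
apply: conn_chern => //.
- by move=> i j k; exact: (has_partials_chern X Y i j k).1.
- by move=> i j k; exact: smooth_cst.
- exact: hopf_hermitian.
move=> i j l p Pp; rewrite partial_hopf // -(chern_compat Y (rho_neq0 Pp) (realC_neq0 x0)
  (sum_wc_zc p)).
by apply: eq_bigr => e _; rewrite hopfE.
Qed.

Lemma hopf_bismut_connection : bismut_connection (hopf x y) hopf_bismut.
Proof.
apply: conn_bismut.
- by move=> i j k; exact: (has_partials_chern X Y j i k).1.
- by move=> i j k; exact: (has_partials_bismut X Y i j k).1.
- exact: hopf_hermitian.
- move=> i j l p Pp; rewrite partial_hopf // -(bismut_compat Y (rho_neq0 Pp) (realC_neq0 x0)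
  (sum_wc_zc p)).
  by apply: eq_bigr => e _; rewrite !hopfE conj_bismut.
move=> i j k p Pp.
transitivity (tors (wc p) (Y * rho p ^+ 2) j i k).
  rewrite -(tors_chern (zc p) (wc p) (rho p) Y (realC_neq0 x0)).
  by apply: eq_bigr => e _; rewrite hopfE.
transitivity (- tors (wc p) (Y * rho p ^+ 2) i j k).
  by rewrite /tors -[RHS]mulrN opprB.
rewrite -(bismut_tors Y (rho_neq0 Pp) (realC_neq0 x0) (sum_wc_zc p)); congr (- _).
by apply: eq_bigr => e _; rewrite hopfE conj_bismut.
Qed.

Lemma curvature_hol_block A B k m p (G : @christoffel R n) :
  (forall A B D p, barred B != barred D -> G A B D p = 0) ->
  curvature G A B (inl k) (inl m) p =
  partial A (G B (inl k) (inl m)) p - partial B (G A (inl k) (inl m)) p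
  + \sum_e (G B (inl k) (inl e) p * G A (inl e) (inl m) p
      - G A (inl k) (inl e) p * G B (inl e) (inl m) p).
Proof.
move=> G0; rewrite /curvature big_idx; congr (_ + _).
rewrite [X in _ + X]big1 ?addr0 // => e _.
by rewrite !(G0 _ (inl k) (inr e)) // !mul0r subrr.
Qed.

Lemma hopf_bismut_mixed i j k m p : punctured p ->
  curvature hopf_bismut (inl i) (inr j) (inl k) (inl m) p
  = rho p * (hopf_q (zc p) (wc p) (rho p) i m * hopf_q (zc p) (wc p) (rho p) k j
     - (2 * (Y / X) - 1) * (hopf_q (zc p) (wc p) (rho p) i j * hopf_q (zc p) (wc p) (rho p) k
       m)).
Proof.
move=> Pp; rewrite curvature_hol_block; last by move=> *; exact: conn0.
rewrite /hopf_bismut /conn (has_partials_bismut X Y j k m).2 // (has_partials_chern X Y k i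
  m).2 //.
by rewrite -(bismut_curv_mixed X Y (rho_neq0 Pp) (sum_wc_zc p)).
Qed.

(** On the antiholomorphic tangent space the curvature is the
conjugate of the one on the holomorphic tangent space. *)
Lemma hopf_bismut_same A B D E p : punctured p -> barred A = barred B ->
  curvature hopf_bismut A B D E p = 0.
Proof.
move=> Pp; have [e|ne] := eqVneq (barred D) (barred E); last by move=> _;
  exact: curvature_conn0.
have H A' B' k m : barred A' = barred B' -> curvature hopf_bismut A' B' (inl k) (inl m) p = 0.
  move=> eAB; rewrite curvature_hol_block; last by move=> *; exact: conn0.
  case: A' eAB => i; case: B' => j // _.
    rewrite /hopf_bismut /conn (has_partials_chern X Y k j m).2 // (has_partials_chern X Y k i
      m).2 //.
    exact: (bismut_curv_hol X Y (rho_neq0 Pp) (sum_wc_zc p)).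
  rewrite /hopf_bismut /conn (has_partials_bismut X Y j k m).2 // (has_partials_bismut X Y i k
    m).2 //.
  exact: (bismut_curv_anti X Y (rho_neq0 Pp) (sum_wc_zc p)).
case: D e => k; case: E => m // _ eAB; first exact: H.
apply/eqP; rewrite -conjc_eq0; apply/eqP; rewrite -curvature_bar //.
- by apply: H; rewrite !barred_bar eAB.
- by move=> i' j' k'; exact: (has_partials_chern X Y j' i' k').1.
- by move=> i' j' k'; exact: (has_partials_bismut X Y i' j' k').1.
Qed.

Lemma hopf_bismut_low i j k l p : punctured p ->
  curvature_low (hopf x y) hopf_bismut (inl i) (inr j) (inl k) (inr l) p
  = X * rho p ^+ 2 * (hopf_q (zc p) (wc p) (rho p) i l * hopf_q (zc p) (wc p) (rho p) k j
     - (2 * (Y / X) - 1) * (hopf_q (zc p) (wc p) (rho p) i j * hopf_q (zc p) (wc p) (rho p) k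
       l)).
Proof.
move=> Pp; rewrite /curvature_low big_idx [X in _ + X]big1 ?addr0; last first.
  by move=> e _; rewrite /gc mulr0.
set q := hopf_q _ _ _.
transitivity (rho p * q k j * (\sum_m q i m * hopf x y p m l)
  - rho p * (2 * (Y / X) - 1) * q i j * (\sum_m q k m * hopf x y p m l)).
  rewrite !mulr_sumr -sumrN -big_split; apply: eq_bigr => m _ /=.
  rewrite hopf_bismut_mixed // -/q.
  by move: (rho p) (q i m) (q k j) (q i j) (q k m) (hopf x y p m l) (2 * (Y / X) - 1) => *;
    ring.
have qg a b : \sum_m q a m * hopf x y p m b = rho p * X * q a b.
  rewrite -(hopf_q_g X Y (rho_neq0 Pp) (sum_wc_zc p)); apply: eq_bigr => m _.
  by rewrite hopfE.
rewrite !qg; move: (rho p) (q i l) (q k j) (q i j) (q k l) (2 * (Y / X) - 1) => *; ring.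
Qed.

Lemma hopf_gup k l p : punctured p ->
  gup (hopf x y) k l p = hopf_inv (zc p) (wc p) (rho p) X Y k l.
Proof.
move=> Pp; pose N : 'M[C]_n := \matrix_(l, k) hopf_inv (zc p) (wc p) (rho p) X Y k l.
have gN : hopf x y p *m N = 1%:M.
  apply/matrixP => a b; rewrite !mxE.
  rewrite -[RHS](hopf_inverse (rho_neq0 Pp) (realC_neq0 x0) (realC_neq0 y0) (sum_wc_zc p)).
  by apply: eq_bigr => e _; rewrite hopfE mxE.
have [gu _] := mulmx1_unit gN.
by rewrite /gup -[invmx _]mulmx1 -gN mulKmx // mxE.
Qed.

Lemma hopf_Tlow i k m p : Tlow (hopf x y) hopf_chern p i k m
  = tors (wc p) (Y * rho p ^+ 2) i k m.
Proof.
rewrite -(tors_chern (zc p) (wc p) (rho p) Y (realC_neq0 x0)).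
rewrite /Tlow /torsion_low big_idx [X in _ + X]big1 ?addr0; last first.
  by move=> e _; rewrite /gc mulr0.
by apply: eq_bigr => e _; rewrite /gc hopfE.
Qed.

Lemma hopf_Tlow_bar i k m p :
  Tlow_bar (hopf x y) hopf_chern p i k m = torsbar (zc p) (Y * rho p ^+ 2) i k m.
Proof.
rewrite /Tlow_bar hopf_Tlow /tors /torsbar expr2 !(conjcM, conjcD,
  conjcN) !conj_rho !conj_wc !conj_kron.
by rewrite conjc_real.
Qed.

Lemma hopf_ricciS i j p : punctured p -> ricciS (hopf x y) hopf_chern p i j =
  rho p * ((n%:R - Y / X) * hopf_q (zc p) (wc p) (rho p) i j
    + (n%:R - 1) * (Y / X) ^+ 2 * (rho p * (wc p i * zc p j))).
Proof.
move=> Pp; rewrite -(chern_ricci (rho_neq0 Pp) (realC_neq0 x0) (realC_neq0 y0) (sum_wc_zc p)).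
apply: eq_bigr => k _; apply: eq_bigr => l _; rewrite hopf_gup //; congr (_ * _).
rewrite /curvature_low big_idx [X in _ + X]big1 ?addr0; last by move=> e _; rewrite /gc mulr0.
apply: eq_bigr => e _; rewrite /gc hopfE; congr (_ * _).
rewrite curvature_hol_block; last by move=> *; exact: conn0.
rewrite /hopf_chern /conn partial_cst (has_partials_chern X Y k i e).2 // big1 ?addr0 ?sub0r //.
by move=> m _; rewrite mul0r mulr0 subrr.
Qed.

Definition flow_x (a b c d : R) : R := - n%:R + y / x * (1 + a + 2 * b + (n%:R - 1) * d).
Definition flow_y (a b c d : R) : R :=
  (y / x) ^+ 2 * ((n%:R - 1) * (a - 1) + (n%:R - 1) ^+ 2 * c).

Lemma hopf_hcf a b c d i j p : punctured p ->
  hcf_rhs (hopf x y) hopf_chern p a b c d i j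
  = rho p * ((flow_x a b c d)%:C * hopf_q (zc p) (wc p) (rho p) i j
     + (flow_y a b c d)%:C * (rho p * (wc p i * zc p j))).
Proof.
move=> Pp; have two0 : (2 : C) != 0 by rewrite pnatr_eq0.
have -> : (flow_x a b c d)%:C = - n%:R + (Y / X) * (1 + a%:C + 2 * b%:C + (n%:R - 1) * d%:C).
  by rewrite /flow_x !(rmorphD, rmorphM, rmorphN, rmorph1, rmorph_nat, fmorphV).
have -> : (flow_y a b c d)%:C = (Y / X) ^+ 2 * ((n%:R - 1) * (a%:C - 1) + (n%:R
  - 1) ^+ 2 * c%:C).
  by rewrite /flow_y !(rmorphXn, rmorphD, rmorphM, rmorphN, rmorph1, rmorph_nat, fmorphV).
rewrite -(hcf_identity (rho_neq0 Pp) (realC_neq0 x0) (realC_neq0 y0) (sum_wc_zc p)) //.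
rewrite -quad1 -quad2 -(quad3 (zc p) (wc p) _ (Y^-1 - X^-1)) -quad4 /hcf_rhs hopf_ricciS //.
congr (_ + _ * _ + _ * _ + _ * _ + _ * (_ * _)); apply: eq_bigr => k _; apply: eq_bigr => l _;
  apply: eq_bigr => m _; apply: eq_bigr => q _;
    by rewrite !hopf_gup // !hopf_Tlow !hopf_Tlow_bar.
Qed.

Lemma hopf_bismut_form p (v t : 'rV[C]_n) : punctured p ->
  let q := hopf_q (zc p) (wc p) (rho p) in
  let S a b := \sum_i \sum_j q i j * a 0 i * conjc (b 0 j) in
  \sum_i \sum_j \sum_k \sum_l
     curvature_low (hopf x y) hopf_bismut (inl i) (inr j) (inl k) (inr l) p
      * v 0 i * conjc (v 0 j) * t 0 k * conjc (t 0 l)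
  = X * rho p ^+ 2 * (S v t * S t v - (2 * (Y / X) - 1) * (S v v * S t t)).
Proof.
move=> Pp q S.
rewrite /S (form_mul_cross q) (form_mul q) mulr_sumr -sumrN -big_split mulr_sumr;
  apply: eq_bigr => i _ /=.
rewrite mulr_sumr -sumrN -big_split mulr_sumr; apply: eq_bigr => j _ /=.
rewrite mulr_sumr -sumrN -big_split mulr_sumr; apply: eq_bigr => k _ /=.
rewrite mulr_sumr -sumrN -big_split mulr_sumr; apply: eq_bigr => l _ /=.
rewrite hopf_bismut_low // -/q.
move: (2 * (Y / X) - 1) (rho p) (q i l) (q k j) (q i j) (q k l) (v 0 i) (conjc (v 0 j)) (t 0 k)
  (conjc (t 0 l)).
by move=> *; ring.
Qed.

End FixedParameters.
End HopfMetrics.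

(** * The ordinary differential equation of the flow *)

Section ODE.
Context {R : realType}.

Lemma is_derive_continuous (f : R -> R) (t l : R) : is_derive t 1 f l -> {for t, continuous f}.
Proof. by move=> [d _]; apply/differentiable_continuous/derivable1_diffP. Qed.

Lemma is_derive_val (f : R -> R) (t l l' : R) : is_derive t 1 f l -> l = l'
  -> is_derive t 1 f l'.
Proof. by move=> h <-. Qed.

Lemma antiderivative (f : R -> R) (a b : R) : {in `[a, b], continuous f} ->
  exists F : R -> R, forall t, a < t < b -> is_derive t 1 F (f t).
Proof.
move=> cf; exists (fun x => (\int[lebesgue_measure]_(t in [set` `[a, x]]) (f t))%R).
move=> t /andP[at_ tb].
have fi : lebesgue_measure.-integrable `[a, b] (EFin \o f).
  apply: continuous_compact_integrable; first exact: segment_compact.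
  exact: continuous_subspace_itv.
have ct : {for t, continuous f} by apply: cf; rewrite in_itv /= !ltW.
have [d e] := continuous_FTC1_closed tb fi at_ ct.
by split; [exact: d|rewrite -derive1E; exact: e].
Qed.

(** Separation of variables: the solution is the inverse function
of an antiderivative of 1 / psi. *)
Lemma autonomous_ode (psi : R -> R) (u0 dl : R) : 0 < dl ->
  (forall u, u0 - dl <= u <= u0 + dl -> {for u, continuous psi} /\ 0 < psi u) ->
  exists (e : R) (u : R -> R), [/\ 0 < e, u 0 = u0 &
    forall t, - e < t < e ->
      [/\ u0 - dl < u t < u0 + dl, is_derive t 1 u (psi (u t)) & 0 < t -> u0 < u t]].
Proof.
move=> dl0 H.
have cV : {in `[u0 - dl, u0 + dl], continuous (fun s => (psi s)^-1)}.
  move=> s; rewrite in_itv /= => /H[cs ps].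
  by apply: continuousV => //; rewrite gt_eqF.
have [F0 dF0] := antiderivative cV.
pose F s := F0 s - F0 u0.
have dF s : u0 - dl < s < u0 + dl -> is_derive s 1 F (psi s)^-1.
  move=> hs; have h0 := dF0 s hs.
  by rewrite -[X in is_derive _ _ _ X]subr0; exact: is_deriveB.
have F_u0 : F u0 = 0 by rewrite /F subrr.
have Finc : {in `]u0 - dl, u0 + dl[ &, {homo F : s t / s < t}}.
  apply: gtr0_derive1_lt_oo.
  - by move=> s; rewrite in_itv /= => /dF[].
  - move=> s; rewrite in_itv /= => hs; rewrite derive1E.
    have [_ ->] := dF s hs; rewrite invr_gt0; apply: (H s _).2.
    by case/andP: hs => /ltW -> /ltW ->.
  - by move=> s; rewrite inE /= in_itv /= => /dF/is_derive_continuous.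
(* A closed interval inside the open one on which F is differentiable. *)
pose p := u0 - dl / 2; pose q := u0 + dl / 2.
have pq : p <= q by rewrite /p /q; lra.
have inn s : p <= s <= q -> u0 - dl < s < u0 + dl by rewrite /p /q; lra.
have Fmono s t : p <= s <= q -> p <= t <= q -> F s < F t -> s < t.
  move=> hs ht st; rewrite ltNge; apply/negP; rewrite le_eqVlt => /predU1P[e|ts].
    by rewrite e ltxx in st.
  have := Finc t s; rewrite !in_itv /= => /(_ (inn _ ht) (inn _ hs) ts).
  by rewrite ltNge (ltW st).
have cF : {within `[p, q], continuous F}.
  apply: continuous_subspace_itv => s; rewrite in_itv /= => /inn/dF.
  exact: is_derive_continuous.
have Fp : F p < 0.
  by rewrite -F_u0; apply: Finc; rewrite ?in_itv /= /p; lra.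
have Fq : 0 < F q.
  by rewrite -F_u0; apply: Finc; rewrite ?in_itv /= /q; lra.
have exg t : exists s, F p <= t <= F q -> p <= s <= q /\ F s = t.
  have [ht|] := boolP (F p <= t <= F q); last by exists 0.
  have [|c] := IVT pq cF (v := t).
    by rewrite (min_idPl _) ?(max_idPr _) // ltW // (lt_trans Fp).
  by rewrite in_itv /= => hc Fc; exists c.
have [g hg] := choice exg.
have gK s : p < s < q -> g (F s) = s.
  move=> /andP[ps sq].
  have [ip iq is_] : [/\ p \in `]u0 - dl, u0 + dl[, q \in `]u0 - dl, u0 + dl[ & s \in `]u0
    - dl, u0 + dl[].
    by rewrite !in_itv /=; split; apply: inn; rewrite ?lexx ?pq ?ltW.
  have hF : F p <= F s <= F q by rewrite !ltW // Finc.
  have [hs Fs] := hg _ hF.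
  apply/eqP; rewrite eq_le !leNgt; apply/andP; split; apply/negP => lt.
    by have := Finc _ _ is_ _ lt; rewrite in_itv /= (inn _ hs) Fs ltxx => /(_ isT).
  by have := Finc _ _ _ is_ lt; rewrite in_itv /= (inn _ hs) Fs ltxx => /(_ isT).
exists (Num.min (- F p) (F q)), g; split.
- by rewrite lt_min oppr_gt0 Fp Fq.
- by rewrite -[in g _]F_u0 gK // /p /q; apply/andP; split; lra.
move=> t /andP[h1 h2].
have m1 : Num.min (- F p) (F q) <= - F p by rewrite ge_min lexx.
have m2 : Num.min (- F p) (F q) <= F q by rewrite ge_min lexx orbT.
have Fpt : F p < t by lra.
have Ftq : t < F q by lra.
have [hs Fs] : p <= g t <= q /\ F (g t) = t by apply: hg; rewrite !ltW.
have [ps sq] : p < g t /\ g t < q.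
  by split; apply: Fmono; rewrite ?lexx ?pq // Fs.
have hin := inn _ hs.
have oin : open [set s | p < s < q].
  rewrite (_ : [set s | _] = `]p, q[%classic); first exact: itv_open.
  by apply/seteqP; split => s /=; rewrite in_itv.
have pin : [set s | p < s < q] (g t) by rewrite /= ps sq.
split => //.
- rewrite -[X in is_derive X _ _ _]Fs -[psi _]invrK.
  apply: is_derive_inverse.
  + apply: filterS (open_near oin pin) => s; exact: gK.
  + apply: filterS (open_near oin pin) => s /andP[h3 h4].
    by apply: (is_derive_continuous (dF s _)); apply: inn; rewrite !ltW.
  + exact: dF.
  + rewrite invr_eq0 gt_eqF //; apply: (H _ _).2.
    by case/andP: hin => /ltW -> /ltW ->.
- move=> t0; apply: Fmono; rewrite ?F_u0 ?Fs //.
  by rewrite /p /q; apply/andP; split; lra.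
Qed.

(** Bootstrapping step for solutions of differential equations. *)
Lemma Ck_antiderivative k (U : set R) (f f' : R -> R) : open U ->
  (forall t, U t -> is_derive t 1 f (f' t)) -> Ck k U f' -> Ck k.+1 U f.
Proof.
move=> oU df kf'; split; first by move=> t Ut; exact: is_derive_continuous (df t Ut).
have diff t : U t -> differentiable f t by move=> /df[d _]; exact/derivable1_diffP.
move=> v; split; first by move=> t Ut; exact: diff_derivable (diff t Ut).
apply: (Ck_ext oU _ (CkM oU (Ck_cst k U v) kf')) => t Ut.
have [d1 d2] := df t Ut.
by rewrite deriveE ?deriv1E //; [rewrite derive1E d2|exact: diff].
Qed.

(** Along a solution u = y / x satisfies
u' = u^2 (m + K u) / y with K = be - al, hence dy/du = be y / (m + K u).
So y = exp (G u) for an antiderivative G of be / (m + K u), and u solves an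
autonomous equation.  The hypothesis keeps m + K u positive near u0. *)
Lemma hopf_flow_exists (al be m u0 : R) : 0 < u0 -> 0 < m + (be - al) * u0 ->
  exists (T : R) (x y : R -> R), [/\ 0 < T, y 0 / x 0 = u0,
    forall k, Ck k [set t | - T < t < T] x /\ Ck k [set t | - T < t < T] y &
    forall t, - T < t < T -> [/\ 0 < x t, 0 < y t,
      is_derive t 1 x (- m + y t / x t * al),
      is_derive t 1 y ((y t / x t) ^+ 2 * be) & 0 < t -> u0 < y t / x t]].
Proof.
move=> u00; set K := be - al => mK0.
(* On this neighbourhood of u0 both u and m + K u stay positive. *)
pose dl := Num.min (u0 / 2) ((m + K * u0) / (2 * (`|K| + 1))).
have nK : 0 <= `|K| by [].
have dl0 : 0 < dl by rewrite lt_min !divr_gt0 //; lra.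
have hpos (u : R) : u0 - dl <= u <= u0 + dl -> 0 < u /\ 0 < m + K * u.
  move=> /andP[h1 h2].
  have d1 : dl <= u0 / 2 by rewrite /dl ge_min lexx.
  have d2 : dl <= (m + K * u0) / (2 * (`|K| + 1)) by rewrite /dl ge_min lexx orbT.
  split; first lra.
  have dK : dl * (`|K| + 1) <= (m + K * u0) / 2.
    move: d2; rewrite invfM mulrA ler_pdivlMr //; lra.
  have : `|K * (u - u0)| <= dl * (`|K| + 1).
    rewrite normrM mulrC ler_pM //; last lra.
    by rewrite ler_norml; apply/andP; split; lra.
  rewrite ler_norml => /andP[h3 _]; lra.
have dlin (t : R) : is_derive t 1 (fun u => m + K * u) K.
  have h := is_deriveD (is_derive_cst m t (1:R)) (is_deriveZ K (is_derive_id t (1:R))).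
  have e : 0 + K *: (1 : R) = K by rewrite add0r; exact: mulr1.
  by rewrite -[X in is_derive _ _ _ X]e; exact: h.
have cM (f h : R -> R) (t : R) : {for t, continuous f} -> {for t, continuous h} ->
    {for t, continuous (fun s => f s * h s)} by move=> cf ch; exact: continuousM cf ch.
have cG : {in `[u0 - dl, u0 + dl], continuous (fun u => be * (m + K * u)^-1)}.
  move=> u; rewrite in_itv /= => /hpos[_ pu].
  suff : {for u, continuous (fun u => be * (m + K * u)^-1)} by [].
  apply: (cM (fun=> be)); first exact: cst_continuous.
  apply: continuousV; first by rewrite gt_eqF.
  exact: is_derive_continuous (dlin u).
have [G dG] := antiderivative cG.
pose Ex u := expR (G u).
have Ex0 (u : R) : 0 < Ex u by exact: expR_gt0.
have dEx (u : R) : u0 - dl < u < u0 + dl -> is_derive u 1 Ex (Ex u * (be * (m + K * u)^-1)).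
  by move=> /dG h; exact: is_derive1_comp.
pose psi u := u ^+ 2 * (m + K * u) * (Ex u)^-1.
have inn u : u0 - dl / 2 <= u <= u0 + dl / 2 -> u0 - dl < u < u0 + dl by move: dl0; clear; lra.
have le_ u : u0 - dl < u < u0 + dl -> u0 - dl <= u <= u0 + dl.
  by case/andP => /ltW -> /ltW ->.
have hpsi u : u0 - dl / 2 <= u <= u0 + dl / 2 -> {for u, continuous psi} /\ 0 < psi u.
  move=> /inn hu; have [pu pmu] := hpos u (le_ _ hu); split; last first.
    by rewrite /psi divr_gt0 // mulr_gt0 // exprn_gt0.
  apply: (cM (fun u => u ^+ 2 * (m + K * u))).
    apply: (cM (fun u => u ^+ 2)); last exact: is_derive_continuous (dlin u).
    exact: exprn_continuous.
  apply: continuousV; first by rewrite gt_eqF.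
  exact: is_derive_continuous (dEx u hu).
have dl20 : 0 < dl / 2 by rewrite divr_gt0.
have [T [u [T0 u_0 Hu]]] := autonomous_ode dl20 hpsi.
pose y t := Ex (u t); pose x t := y t * (u t)^-1.
have pos t : - T < t < T -> [/\ 0 < u t, 0 < m + K * u t & u0 - dl < u t < u0 + dl].
  move=> /Hu[/andP[/ltW h1 /ltW h2] _ _].
  have hin := inn (u t) (introT andP (conj h1 h2)).
  by have [] := hpos _ (le_ _ hin).
have yx t : - T < t < T -> y t / x t = u t.
  by move=> /pos[p1 _ _]; rewrite /x invfM invrK mulrA divff ?mul1r // gt_eqF // Ex0.
have dy t : - T < t < T -> is_derive t 1 y ((y t / x t) ^+ 2 * be).
  move=> ht; rewrite yx //; have [p1 p2 p3] := pos t ht; have [_ du _] := Hu t ht.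
  have h := is_derive1_comp (dEx _ p3) du.
  apply: (is_derive_val h).
  have e0 := Ex0 (u t); rewrite /psi; move: (Ex (u t)) e0 p2 => E e0 p2.
  by field; rewrite !gt_eqF.
have dx t : - T < t < T -> is_derive t 1 x (- m + y t / x t * al).
  move=> ht; have [p1 p2 p3] := pos t ht; have [_ du _] := Hu t ht.
  have u0t : u t != 0 by rewrite gt_eqF.
  apply: (is_derive_val (is_deriveM (dy t ht) (is_deriveV u0t du))).
  rewrite yx // /psi /x /y; have e0 := Ex0 (u t).
  rewrite /GRing.scale /= /K; move: (u t) (Ex (u t)) e0 u0t => w E e0 w0.
  by field; rewrite w0 gt_eqF.
have px t : - T < t < T -> 0 < x t.
  by move=> /pos[p1 _ _]; rewrite /x /y divr_gt0.
exists T, x, y; split => //.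
- by rewrite yx ?u_0 // oppr_lt0 T0.
- have oU : open [set t : R | - T < t < T].
    rewrite (_ : [set t | _] = `]- T, T[%classic); first exact: itv_open.
    by apply/seteqP; split => s /=; rewrite in_itv.
  elim=> [|k [kx ky]].
    by split; split => // t ht; [exact: is_derive_continuous (dx t ht)|exact:
      is_derive_continuous (dy t ht)].
  have kq : Ck k [set t : R | - T < t < T] (fun t => y t / x t).
    by apply: CkM => //; apply: CkV => // t ht; rewrite gt_eqF // px.
  split.
    apply: (Ck_antiderivative oU dx); apply: CkD => //; first exact: Ck_cst.
    by apply: CkM => //; exact: Ck_cst.
  apply: (Ck_antiderivative oU dy); apply: CkM => //; last exact: Ck_cst.
  exact: CkM.
- move=> t ht; split; [exact: px|exact: Ex0|exact: dx|exact: dy|].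
  by rewrite yx //; have [_ _] := Hu t ht.
Qed.
End ODE.

(** * The sign of the Bismut curvature and the flow on the Hopf manifold *)

Section Criterion.
Context {R : realType} {n : nat}.
Local Notation C := R[i].
Local Notation Cn := (Cn R n).
Local Notation q p := (hopf_q (zc p) (wc p) (rho p)).
Implicit Types (p : Cn) (x y : R).

(** In dimension 2 the projection q has rank one, so its 2 x 2 minors
vanish. *)
Lemma hopf_q_rank1 p i j k l : n = 2%N -> punctured p ->
  q p i l * q p k j = q p i j * q p k l.
Proof.
move=> n2 Pp; subst n.
have [->|ik] := eqVneq i k; first by rewrite mulrC.
have [->|jl] := eqVneq j l; first by [].
have e2 (a : 'I_2) : a = ord0 \/ a = ord_max by case: a => [[|[|[]]]] // h; [left|right];
  apply: val_inj.
have nz : (@ord0 1 == ord_max) = false by [].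
have zn : (@ord_max 1 == ord0) = false by [].
have := sum_wc_zc p; rewrite big_ord_recl big_ord1.
rewrite (_ : lift ord0 ord0 = ord_max); last exact: val_inj.
have := rho_neq0 Pp.
have main (r z0 z1 w0 w1 : C) : r != 0 -> w0 * z0 + w1 * z1 = r^-1 ->
    (1 - r * (w0 * z0)) * (1 - r * (w1 * z1)) = (0 - r * (w0 * z1)) * (0 - r * (w1 * z0)).
  move=> r0 e; apply/eqP; rewrite -subr_eq0.
  have -> : (1 - r * (w0 * z0)) * (1 - r * (w1 * z1)) - (0 - r * (w0 * z1)) * (0
    - r * (w1 * z0))
     = 1 - r * (w0 * z0 + w1 * z1) by ring.
  by rewrite e mulfV // subrr.
move=> r0 e; have M := main _ _ _ _ _ r0 e.
rewrite /hopf_q /kron.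
case: (e2 i) ik => ->; case: (e2 k) => ->; rewrite ?eqxx // => _;
case: (e2 j) jl => ->; case: (e2 l) => ->; rewrite ?eqxx ?nz ?zn //= => _;
  rewrite ?mulr1n ?mulr0n; first [exact: M | rewrite mulrC M;
    exact: mulrC | exact: esym M | rewrite mulrC -M; exact: mulrC].
Qed.

(** For n = 2, [hopf_q_rank1] turns the curvature form into 2 - 2u times
a nonnegative quantity; for n >= 3 both of its terms are nonnegative. *)
Lemma hopf_bgnn x y : (0 < x) -> (0 < y) -> 2 * (y / x) - 1 <= (n == 2%N)%:R ->
  bismut_griffiths_nonneg (hopf x y : @metric_field R n).
Proof.
move=> x0 y0 hc; exists (hopf_bismut x y); split; first exact: hopf_bismut_connection.
move=> p Pp; split.
  move=> A B D E e; rewrite /curvature_low big1 // => F _.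
  have [eAB|nAB] := eqVneq (barred A) (barred B).
    by rewrite hopf_bismut_same // mul0r.
  have eDE : barred D = barred E by case: e => // eAB; rewrite eAB eqxx in nAB.
  have [eFE|nFE] := eqVneq (barred F) (barred E).
    rewrite (_ : gc (hopf x y) F E p = 0) ?mulr0 //.
    by move: eFE; case: (F); case: (E).
  by rewrite curvature_conn0 ?mul0r // eDE eq_sym.
move=> v t _ _; rewrite hopf_bismut_form //=.
set c := 2 * _ - 1; pose S (a b : 'rV[C]_n) := \sum_i \sum_j q p i j * a 0 i * conjc (b 0 j).
rewrite -/(S v t) -/(S t v) -/(S v v) -/(S t t).
have cE : c = (2 * (y / x) - 1)%:C.
  by rewrite /c !(rmorphB, rmorphM, rmorph1, rmorph_nat, fmorphV).
have S0 a : 0 <= S a a by exact: hopf_q_form_ge0.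
have Sc : S t v = conjc (S v t).
  rewrite /S exchange_big conjc_sum; apply: eq_bigr => i _; rewrite conjc_sum;
    apply: eq_bigr => j _.
  by rewrite !conjcM conj_hopf_q conjcK mulrAC.
apply: mulr_ge0.
  apply: mulr_ge0; first by rewrite lecR ltW.
  by rewrite exprn_ge0 // ltW // rho_gt0.
rewrite cE; move: hc; case: eqP => [n2|_] hc.
  have -> : S v t * S t v = S v v * S t t.
    rewrite /S (form_mul_cross (q p)) (form_mul (q p)).
    apply: eq_bigr => i _; apply: eq_bigr => j _; apply: eq_bigr => k _; apply: eq_bigr => l _.
    have := hopf_q_rank1 i j k l n2 Pp.
    move: (q p i l) (q p k j) (q p i j) (q p k l) (v 0 i) (conjc (t 0 l)) (t 0 k) (conjc (v 0
      j)).
    move=> a b a' b' c1 c2 c3 c4 e.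
    transitivity (a * b * (c1 * c2 * c3 * c4)); first by ring.
    by rewrite e; ring.
  rewrite -[X in X - _]mul1r -mulrBl; apply: mulr_ge0; last exact: mulr_ge0.
  by rewrite -[1](rmorph1 (real_complex R)) -rmorphB /= lecR subr_ge0.
rewrite -mulNr; apply: addr_ge0; first by rewrite Sc mulcJ_ge0.
by apply: mulr_ge0; [rewrite -rmorphN /= lecR oppr_ge0|exact: mulr_ge0].
Qed.

(** Evaluate at the first unit vector, where q is the projection
onto the other coordinates, and on the vectors e_2 and e_n: these coincide
for n = 2 and are orthogonal for n >= 3. *)
Lemma hopf_not_bgnn x y : (2 <= n)%N -> (0 < x) -> (0 < y) ->
  (n == 2%N)%:R < 2 * (y / x) - 1 -> ~ bismut_griffiths_nonneg (hopf x y : @metric_field R n).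
Proof.
move=> n2 x0 y0 hc [Gam [bG H]].
have n0 : (0 < n)%N by apply: leq_trans n2.
pose o := Ordinal n0; pose al := Ordinal (n2 : (1 < n)%N).
have bl : (n.-1 < n)%N by rewrite ltn_predL.
pose be := Ordinal bl.
pose p : Cn := (delta_mx 0 o, 0).
have zp k : zc p k = (k == o)%:R.
  rewrite /zc /zeta /zcoord /p /= !mxE eqxx /=.
  by case: (k == o).
have wp k : wc p k = (k == o)%:R by rewrite -conj_zc zp conjc_nat.
have Pp : punctured p.
  rewrite /punctured /=; apply/eqP => /(congr1 (fun r : Cn => r.1 0 o)).
  by rewrite /p /= !mxE !eqxx /= => /eqP; rewrite oner_eq0.
have rp : rho p = 1.
  apply: invr_inj; rewrite invr1 -sum_wc_zc (bigD1 o) //= big1 ?addr0 ?zp ?wp ?eqxx ?mulr1 //.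
  by move=> k /negbTE ko; rewrite zp wp ko mulr0.
have qp i j : i != o -> q p i j = (i == j)%:R.
  by move=> /negbTE io; rewrite /hopf_q zp wp io mul0r mulr0 subr0.
have ao : al != o by [].
have bo : be != o by rewrite -val_eqE /= -lt0n -subn1 subn_gt0.
have ab : (al == be) = (n == 2%N).
  by rewrite -val_eqE /= -[in RHS](prednK n0) eqSS eq_sym.
have [_ /(_ (delta_mx 0 al) (delta_mx 0 be))] := H p Pp.
have d0 k : (delta_mx 0 k : 'rV[C]_n) != 0.
  apply/eqP => /rowP/(_ k); rewrite !mxE !eqxx => /eqP; by rewrite oner_eq0.
move=> /(_ (d0 _) (d0 _)).
have lowE i j k l : curvature_low (hopf x y) Gam (inl i) (inr j) (inl k) (inr l) p =
     curvature_low (hopf x y) (hopf_bismut x y) (inl i) (inr j) (inl k) (inr l) p.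
  apply: eq_bigr => E _; congr (_ * _); apply: eq_curvature => // A B D r Pr.
  exact: (bismut_unique _ _ _ (hopf_hermitian x0 y0) bG (hopf_bismut_connection x0 y0)).
under eq_bigr => i _ do under eq_bigr => j _ do under eq_bigr => k _ do
  under eq_bigr => l _ do rewrite lowE.
rewrite (hopf_bismut_form x y _ _ Pp).
have S a b : \sum_i \sum_j q p i j * (delta_mx 0 a : 'rV[C]_n) 0 i * conjc ((delta_mx 0 b :
  'rV[C]_n) 0 j) = q p a b.
  rewrite (bigD1 a) //= [X in _ + X]big1 ?addr0; last first.
    by move=> i /negbTE ia; rewrite big1 // => j _; rewrite !mxE ia andbF mulr0 mul0r.
  rewrite (bigD1 b) //= [X in _ + X]big1 ?addr0; last first.
    by move=> j /negbTE jb; rewrite !mxE jb andbF conjc0 mulr0.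
  by rewrite !mxE !eqxx conjc1 !mulr1.
rewrite !S !qp // !eqxx [be == al]eq_sym ab rp expr1n !mulr1.
have -> : (n == 2%N)%:R * (n == 2%N)%:R = (n == 2%N)%:R :> C by case: (n == 2%N);
  rewrite ?mulr1 ?mulr0.
have -> : x%:C * ((n == 2%N)%:R - (2 * (y%:C / x%:C) - 1)) = (x * ((n == 2%N)%:R
  - (2 * (y / x) - 1)))%:C :> C.
  by rewrite !(rmorphM, rmorphB, rmorph1, rmorph_nat, fmorphV).
by rewrite lecR pmulr_rge0 // subr_ge0 leNgt hc.
Qed.

(** A deck transformation is a homothety composed with a diagonal
unitary map, because the al_i have the same modulus. *)
Lemma hopf_invariant (al : 'rV[C]_n) x y : linear_hopf al -> 0 < x -> 0 < y ->
  hopf_metric al (hopf x y).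
Proof.
move=> [al0 aln _] x0 y0; split; first exact: hopf_hermitian.
move=> p Pp i j; pose s := al 0 i * conjc (al 0 i).
have sE k : al 0 k * conjc (al 0 k) = s by rewrite /s -!sqr_normc (aln k i).
have [k0 ak0] : exists k, al 0 k != 0.
  apply/existsP; apply: contraNT al0 => /existsPn h; apply/eqP/rowP => k; rewrite mxE.
  by have := h k; rewrite negbK => /eqP.
have s0 : s != 0 by rewrite -(sE k0) mulf_neq0 // conjc_eq0.
have zd k : zc (deck al p) k = al 0 k * zc p k.
  rewrite /zc /zeta {1}/zcoord /deck /= !mxE; by case: (al 0 k * zcoord p k).
have wd k : wc (deck al p) k = conjc (al 0 k) * wc p k by rewrite -conj_zc zd conjcM.
have rd : rho (deck al p) = s^-1 * rho p.
  apply: invr_inj; rewrite -sum_wc_zc invfM invrK -sum_wc_zc mulr_sumr; apply: eq_bigr => k _.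
  by rewrite zd wd -(sE k); move: (al 0 k) (conjc (al 0 k)) (wc p k) (zc p k) => *; ring.
rewrite !hopfE /hopf_g rd zd wd.
have e2 : al 0 i * conjc (al 0 j) * (conjc (al 0 i) * al 0 j) = s ^+ 2.
  by rewrite expr2 -{1}(sE i) -(sE j); move: (al 0 i) (al 0 j) (conjc (al 0 i)) (conjc (al 0
    j)) => *; ring.
have e1 : al 0 i * conjc (al 0 j) * kron C i j = s * kron C i j.
  by rewrite /kron; case: eqP => [<-|_]; rewrite ?mulr0 // sE.
transitivity (s^-1 * rho p * x%:C * (al 0 i * conjc (al 0 j) * kron C i j)
   + (y%:C - x%:C) * (s^-1 * rho p) ^+ 2 * (al 0 i * conjc (al 0 j) * (conjc (al 0 i)
     * al 0 j)) * (wc p i * zc p j)).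
  by move: (s^-1 * rho p) (kron C i j) (al 0 i) (al 0 j) (conjc (al 0 i)) (conjc (al 0 j)) (wc
    p i) (zc p j) (x%:C) (y%:C) => *; ring.
have main (t r k w z X Y : C) : t != 0 ->
    t^-1 * r * X * (t * k) + (Y - X) * (t^-1 * r) ^+ 2 * t ^+ 2 * (w * z)
    = r * X * k + (Y - X) * r ^+ 2 * (w * z) by move=> t0; field.
by rewrite e1 e2 main.
Qed.

(** The metric is linear in the parameters (x, y), so it is a
combination of the two coefficients with parameters (1, 0) and (0, 1). *)
Lemma hopf_family_smooth (T : R) (xf yf : R -> R) (i j : 'I_n) :
  (forall k, Ck k [set t | - T < t < T] xf /\ Ck k [set t | - T < t < T] yf) ->
  smooth [set tp : R * Cn | - T < tp.1 < T /\ punctured tp.2]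
    (fun tp => hopf (xf tp.1) (yf tp.1) tp.2 i j).
Proof.
move=> kxy; set U := [set tp : R * Cn | _].
have lf a (u v : R * Cn) : fst (a *: u + v) = a *: fst u + fst v by [].
have ls a (u v : R * Cn) : snd (a *: u + v) = a *: snd u + snd v by [].
have cf : continuous (fst : R * Cn -> R) by move=> u; exact: cvg_fst.
have cs : continuous (snd : R * Cn -> Cn) by move=> u; exact: cvg_snd.
have oU : open U.
  rewrite (_ : U = (fst @^-1` [set t | - T < t < T]) `&` (snd @^-1` @punctured R n)) //.
  apply: openI; apply: open_comp => //; last exact: open_punctured.
  rewrite (_ : [set t : R | _] = `]- T, T[%classic); first exact: itv_open.
  by apply/seteqP; split => s /=; rewrite in_itv.
have sx : smooth U (fun tp => (xf tp.1)%:C).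
  apply: smooth_real => k; apply: (Ck_comp_lin lf cf _ (kxy k).1).
  by move=> u [].
have sy : smooth U (fun tp => (yf tp.1)%:C).
  apply: smooth_real => k; apply: (Ck_comp_lin lf cf _ (kxy k).2).
  by move=> u [].
have sp (f : Cn -> C) : smooth (@punctured R n) f -> smooth U (fun tp => f tp.2).
  move=> sf k; split; [apply: (Ck_comp_lin ls cs _ (sf k).1)|apply: (Ck_comp_lin ls cs _ (sf
    k).2)];
  by move=> u [].
have s10 := sp _ (has_partials_hopf_g 1 0 i j).1.
have s01 := sp _ (has_partials_hopf_g 0 1 i j).1.
apply: (smooth_ext oU _ (smoothD oU (smoothM oU sx s10) (smoothM oU sy s01))).
move=> u _; rewrite hopfE /hopf_g.
by move: (xf u.1)%:C (yf u.1)%:C (rho u.2) (kron C i j) (wc u.2 i) (zc u.2 j) => *; ring.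
Qed.

Lemma cderive_combination (xf yf : R -> R) (t lx ly : R) (u v : C) :
  is_derive t 1 xf lx -> is_derive t 1 yf ly ->
  cderive (1 : R) (fun s => (xf s)%:C * u + (yf s)%:C * v) t = lx%:C * u + ly%:C * v.
Proof.
move=> dx dy.
have D (a b : R) : 'D_1 (fun s => xf s * a + yf s * b) t = lx * a + ly * b.
  have h := is_deriveD (is_deriveM dx (is_derive_cst a t 1)) (is_deriveM dy (is_derive_cst b t
    1)).
  have [_ e] := h; rewrite [LHS]e /GRing.scale /= !mulr0 !add0r mulrC; congr (_ + _);
    exact: mulrC.
rewrite /cderive.
have -> : (fun s => complex.Re ((xf s)%:C * u + (yf s)%:C * v))
  = (fun s => xf s * complex.Re u + yf s * complex.Re v).
  by apply/funext => s; rewrite complex_ReD !complex_ReM /= !mul0r !subr0.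
have -> : (fun s => complex.Im ((xf s)%:C * u + (yf s)%:C * v))
  = (fun s => xf s * complex.Im u + yf s * complex.Im v).
  by apply/funext => s; rewrite complex_ImD !complex_ImM /= !mul0r !addr0.
rewrite !D; apply/eqP; rewrite eq_complex !(complex_ReD, complex_ImD, complex_ReM,
  complex_ImM) /=.
by rewrite !mul0r !subr0 !addr0 !eqxx.
Qed.

Lemma hopf_cderive (xf yf : R -> R) (t lx ly : R) p i j : is_derive t 1 xf lx
  -> is_derive t 1 yf ly ->
  cderive (1 : R) (fun s => hopf (xf s) (yf s) p i j) t
  = rho p * (lx%:C * q p i j + ly%:C * (rho p * (wc p i * zc p j))).
Proof.
move=> dx dy.
have main (r k w z X Y : C) : r * X * k + (Y - X) * r ^+ 2 * (w * z)
  = X * (r * (k - r * (w * z))) + Y * (r * (r * (w * z))) by ring.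
rewrite (_ : (fun s => _) = (fun s => (xf s)%:C * (rho p * q p i j)
   + (yf s)%:C * (rho p * (rho p * (wc p i * zc p j))))); last first.
  by apply/funext => s; rewrite hopfE; exact: main.
rewrite (cderive_combination _ _ dx dy).
move: (rho p) (q p i j) (wc p i) (zc p j) (lx%:C) (ly%:C) => *; ring.
Qed.

End Criterion.

Theorem proposition5 (R : realType) (n : nat) (hn : (2 <= n)%N)
  (al : 'rV[R[i]]_n) (hal : linear_hopf al) (a b c d : R)
  (habcd : (n%:R - 2) * a - 2 * b + (n%:R - 1) ^+ 2 * c - (n%:R - 1) * d
           > n%:R * (gamma_ R n / (gamma_ R n + 1))) :
  ~ hcf_preserves_bgnn al a b c d.
Proof.
move=> pres.
pose coef_x := 1 + a + 2 * b + (n%:R - 1) * d.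
pose be := (n%:R - 1) * (a - 1) + (n%:R - 1) ^+ 2 * c.
pose u0 := gamma_ R n + 1.
have [u00 gE] : 0 < u0 /\ 2 * u0 - 1 = (n == 2%N)%:R.
  by rewrite /u0 /gamma_; case: (n == 2%N); rewrite /= ?mulr1n ?mulr0n; split; lra.
have h0 : 0 < n%:R + (be - coef_x) * u0.
  have e : n%:R * (gamma_ R n / (gamma_ R n + 1)) * u0 = n%:R * (u0 - 1).
    by rewrite -/u0 /u0 addrK -mulrA divfK // gt_eqF.
  have -> : n%:R + (be - coef_x) * u0 = ((n%:R - 2) * a - 2 * b + (n%:R - 1) ^+ 2 * c
      - (n%:R - 1) * d) * u0 - n%:R * (u0 - 1).
    by rewrite /be /coef_x; move: (u0) => w; ring.
  by rewrite subr_gt0 -e ltr_pM2r.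
have [T [xf [yf [T0 y0 kxy H]]]] := hopf_flow_exists u00 h0.
have H00 : - T < 0 < T by rewrite oppr_lt0 T0.
have sub t : 0 <= t < T -> - T < t < T by move=> /andP[t0 tT]; rewrite tT andbT; lra.
have [x00 y00 _ _ _] := H 0 H00.
have sol : hcf_solution al a b c d T (fun t => hopf (xf t) (yf t)).
  split.
  - by exists T => // i j; exact: hopf_family_smooth.
  - by move=> t /sub/H[xt yt _ _ _]; exact: hopf_invariant.
  move=> t /sub/H[xt yt dx dy _].
  exists (hopf_chern (xf t) (yf t)); split; first exact: hopf_chern_connection.
  move=> p Pp i j; rewrite (hopf_cderive p i j dx dy) hopf_hcf //.
have bg0 : bismut_griffiths_nonneg (hopf (xf 0) (yf 0) : @metric_field R n).
  by apply: hopf_bgnn => //; rewrite y0 gE.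
have tin : 0 <= T / 2 < T by apply/andP; split; lra.
have t0 : 0 < T / 2 by lra.
have [xt yt _ _ /(_ t0) ut] := H _ (sub _ tin).
apply: (hopf_not_bgnn hn xt yt).
  rewrite -gE; lra.
by apply: (pres _ (hopf_invariant hal x00 y00) bg0 T _ T0 sol) => //.
Qed.
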